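(* Let $r\geq 1$, $n\geq 1$ and $1\leq k\leq rn$ be integers. Then $$E^*(\mathcal{B}^{(r)}_{n,k},z)=\sum_{\substack{(\sigma,c)\in\mathfrak{S}^{(r)}_n\\ \mathrm{fexc}(\sigma,c)=rn-k}} z^{\lceil \mathrm{fdes}(\sigma,c)/r\rceil}.$$
   Context: Ehrhart series: for $\mathcal{X}\subset\mathbb{R}^n$ (here a convex integral polytope with possibly some faces removed), $E(\mathcal{X},t)$ denotes the polynomial in $t$ such that $E(\mathcal{X},t)=\#(t\mathcal{X}\cap\mathbb{Z}^n)$ for every integer $t>0$, where $t\mathcal{X}=\{tx: x\in\mathcal{X}\}$; and $E^*(\mathcal{X},z):=(1-z)^{n+1}\sum_{t\geq 0}E(\mathcal{X},t)z^t$ (the value at $t=0$ is that of the polynomial). Multi-hypersimplices: for $1\le k<rn$, $\mathcal{B}^{(r)}_{n,k}=\{v\in[0,r]^n : k-1\leq\sum_i v_i<k\}$; for $k=rn$, $\mathcal{B}^{(r)}_{n,k}=\{v\in[0,r]^n : k-1\leq\sum_i v_i\leq k\}$. Colored permutations: $\mathfrak{S}_n^{(r)}$ is the set of pairs $(\sigma,c)$ with $\sigma\in\mathfrak{S}_n$ a permutation of $\{1,\dots,n\}$ and $c=(c_1,\dots,c_n)\in\{0,1,\dots,r-1\}^n$. Define $\mathrm{fexc}(\sigma,c)=r\cdot\#\{i\in\{1,\dots,n\}:\sigma_i>i\text{ and }c_i=0\}+\sum_{i=1}^n c_i$; $\mathrm{des}(\sigma,c)=\#\{i : 1\leq i\leq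 n-1,\ c_i>c_{i+1}\text{, or }c_i=c_{i+1}\text{ and }\sigma_i>\sigma_{i+1}\}$; $\mathrm{fdes}(\sigma,c)=r\cdot\mathrm{des}(\sigma,c)+c_n$. *)

(* Defs.v *)
From mathcomp Require Import all_boot all_order all_algebra all_fingroup.
From mathcomp Require Import boolp classical_sets functions cardinality reals.

Set Implicit Arguments.
Unset Strict Implicit.
Unset Printing Implicit Defensive.

Import Order.TTheory GRing.Theory Num.Theory.
Local Open Scope ring_scope.
Local Open Scope classical_set_scope.
Local Open Scope card_scope.

(* Formal power series with rational coefficients, as coefficient sequences. *)
Definition fps := nat -> rat.

Definition fps_mul (a b : fps) : fps :=
  fun m => \sum_(i < m.+1) a i * b (m - i)%N.

Definition fps_of_poly (p : {poly rat}) : fps := fun m => p`_m.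

Definition dilate (R : realType) (n : nat) (t : nat) (X : set 'rV[R]_n) :
    set 'rV[R]_n :=
  [set t%:R *: x | x in X].

Definition integer_lattice (R : realType) (n : nat) : set 'rV[R]_n :=
  [set v | forall i, v ord0 i \is a Num.int].
Arguments integer_lattice : clear implicits.

(* [A #= `I_m] says that A is finite with exactly m elements. *)
Definition is_ehrhart (R : realType) (n : nat) (X : set 'rV[R]_n)
    (p : {poly rat}) : Prop :=
  forall t : nat, (0 < t)%N ->
    exists2 m : nat, dilate t X `&` integer_lattice R n #= `I_m
                   & p.[t%:R] = m%:R.

Lemma is_ehrhart_unique (R : realType) (n : nat) (X : set 'rV[R]_n)
    (p q : {poly rat}) :
  is_ehrhart X p -> is_ehrhart X q -> p = q.
Proof.
move=> Hp Hq; apply/eqP; rewrite -subr_eq0; apply/negPn/negP => nz.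
have pq t : (0 < t)%N -> p.[t%:R] = q.[t%:R].
  move=> t0; have [a Aa ->] := Hp t t0; have [b Ab ->] := Hq t t0.
  congr (_%:R); apply/card_eq_II.
  by apply: card_eq_trans Ab; rewrite card_eq_sym.
pose s : seq rat := [seq i.+1%:R | i <- iota 0 (size (p - q))].
have := @max_poly_roots _ (p - q) s nz.
rewrite size_map size_iota ltnn => H; suff: false by [].
apply: H.
  by apply/allP => x /mapP [i _ ->]; rewrite rootE hornerD hornerN pq ?subrr.
rewrite map_inj_uniq ?iota_uniq // => i j /eqP.
by rewrite eqr_nat eqSS => /eqP.
Qed.

(* Meaningful only when [is_ehrhart X] is satisfiable. *)
Definition ehrhart (R : realType) (n : nat) (X : set 'rV[R]_n) : {poly rat} :=
  xget 0 [set p | is_ehrhart X p].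

Definition ehrhart_star (R : realType) (n : nat) (X : set 'rV[R]_n) : fps :=
  fps_mul (fps_of_poly ((1 - 'X) ^+ n.+1)) (fun t => (ehrhart X).[t%:R]).

(* [x < y ?<= if b] is [x <= y] when b holds, and [x < y] otherwise. *)
Definition multi_hypersimplex (R : realType) (r n k : nat) : set 'rV[R]_n :=
  [set v | [/\ forall i, 0 <= v ord0 i <= r%:R,
               k%:R - 1 <= \sum_i v ord0 i
             & \sum_i v ord0 i < k%:R ?<= if (k == r * n)%N]].
Arguments multi_hypersimplex : clear implicits.

Definition colored_perm (r n : nat) : finType :=
  ('S_n * n.-tuple 'I_r)%type.

Section Statistics.
Variables (r n : nat) (x : colored_perm r n).
Local Open Scope nat_scope.

Let sigma : 'S_n := x.1.
Let color (i : 'I_n) : nat := tnth x.2 i.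

Definition fexc : nat :=
  r * #|[set i : 'I_n | (i < sigma i) && (color i == 0)]%SET|
    + \sum_(i < n) color i.

Definition des : nat :=
  #|[set p : 'I_n * 'I_n | (p.2 == p.1.+1 :> nat) &&
      ((color p.2 < color p.1)
       || (color p.1 == color p.2) && (sigma p.2 < sigma p.1))]%SET|.

End Statistics.

(* The last letter c_n of the color word; the default 0 is used only if n = 0. *)
Definition last_color (r n : nat) (x : colored_perm r n) : nat :=
  last 0%N [seq nat_of_ord a | a <- x.2].

Definition fdes (r n : nat) (x : colored_perm r n) : nat :=
  (r * des x + last_color x)%N.

(* [Num.ceil] is int-valued; the argument is nonnegative, so [absz] is exact. *)
Definition ceil_fdes (r n : nat) (x : colored_perm r n) : nat :=
  absz (Num.ceil ((fdes x)%:R / r%:R : rat)).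

(* Main.v *)
(* Since C(t + n - d, n) counts the sequences compatible with a colored
   permutation whose [ceil_fdes] is d, the sum of x^fexc C(t + n - ceil_fdes, n)
   over colored permutations is the sum over the words w in {0, ..., rt}^n of
   x^fexc(std w), where std w is the standardization of w colored by the
   residues of its letters mod r.  Replacing v by rt - v in the dilated
   hypersimplex, the theorem becomes the identity
     sum_w x^fexc(std w) = sum_v x^(max(0, |v| - 1) div t)
   over words w and vectors v in {0, ..., rt}^n, for all t > 0; the Ehrhart
   polynomial and its star then follow from the generating function of
   C(t + n - d, n).
     With u marking the length, both generating functions are inverted.  For
   the vectors, the series G(s) obtained by starting the sum |v| at s satisfies
   G(s + 1) = c G(s) for 0 <= s < t, with c = (1 - u) / (1 - u x^r), and
   G(s + t) = x G(s) for s > 0.  For the words, let W be the series of the words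
   in the letters larger than a letter b.  Merging b with a still smaller letter
   shows that adding b to the alphabet turns 1 / W into
   (1 - p) / (1 - q) (1 / W - q), where p and q are the weights of b at a
   non-excedance and at an excedance.  The key to the induction: the words with
   V occurrences of a smallest, weightless letter, whose positions among the
   first V places are prescribed, have series W (W - 1)^j, where j is the number
   of the first V places left to other letters. *)

Require Import Defs.
From mathcomp Require Import all_boot all_order all_algebra all_fingroup.
From mathcomp Require Import boolp classical_sets functions cardinality reals.
From mathcomp Require Import zify ring.

Set Implicit Arguments.
Unset Strict Implicit.
Unset Printing Implicit Defensive.

Import Order.TTheory GRing.Theory Num.Theory.
Local Open Scope ring_scope.

(** * Excedances of words *)

Fixpoint words (T : Type) (s : seq T) (n : nat) : seq (seq T) :=
  if n is n'.+1 then [seq a :: w | a <- s, w <- words s n'] else [:: [::]].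

Lemma big_wordsS (A : nmodType) (T : Type) (s : seq T) n (F : seq T -> A) :
  \sum_(w <- words s n.+1) F w = \sum_(a <- s) \sum_(w <- words s n) F (a :: w).
Proof. by rewrite /= big_allpairs_dep. Qed.

Lemma big_words_cat (A : nmodType) (T : Type) (s : seq T) m n
    (F : seq T -> A) :
  \sum_(w <- words s (m + n)) F w =
  \sum_(w <- words s m) \sum_(w' <- words s n) F (w ++ w').
Proof.
elim: m F => [|m IHm] F; first by rewrite big_seq1.
by rewrite addSn !big_wordsS; apply: eq_bigr => a _; rewrite IHm.
Qed.

Lemma size_words (T : eqType) (s : seq T) n w : w \in words s n -> size w = n.
Proof.
elim: n w => [|n IHn] w; first by rewrite inE => /eqP->.
by case/allpairsP => -[a v] [/= _ /IHn vn ->] /=; rewrite vn.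
Qed.

Lemma words_sub (T : eqType) (s : seq T) n w :
  w \in words s n -> {subset w <= s}.
Proof.
elim: n w => [|n IHn] w; first by rewrite inE => /eqP->.
case/allpairsP => -[a v] [/= sa /IHn vs ->] b.
by rewrite inE => /predU1P[->|/vs].
Qed.

Lemma big_words_map (A : nmodType) (T T' : Type) (f : T -> T') (s : seq T) n
    (F : seq T' -> A) :
  \sum_(w <- words (map f s) n) F w = \sum_(w <- words s n) F (map f w).
Proof.
elim: n F => [|n IHn] F; first by rewrite !big_seq1.
by rewrite !big_wordsS big_map; apply: eq_bigr => a _; rewrite IHn.
Qed.

Arguments words : simpl never.

(** * Splitting a merged letter into the letters 0 and 1 *)

Notation bits := [:: false; true].

Lemma big_bits (A : nmodType) (F : bool -> A) :
  \sum_(b <- bits) F b = F false + F true.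
Proof. by rewrite !big_cons big_nil addr0. Qed.

(* Undoes the merging of the letters 0 and 1: the successive letters 0 of [v]
   become 0 or 1 as prescribed by [z], and the other letters are shifted. *)
Fixpoint expand (v : seq nat) (z : seq bool) : seq nat :=
  match v, z with
  | 0%N :: v', b :: z' => (b : nat) :: expand v' z'
  | 0%N :: v', [::] => 0%N :: expand v' [::]
  | i.+1 :: v', _ => i.+2 :: expand v' z
  | [::], _ => [::]
  end.

(** Every word comes from exactly one pair: [v] is its image under the merging, and [z] records
    which merged letters were 1. *)
Lemma big_words_expand (A : nmodType) h n (F : seq nat -> A) :
  \sum_(w <- words (iota 0 h.+2) n) F w =
  \sum_(v <- words (iota 0 h.+1) n)
    \sum_(z <- words bits (count_mem 0%N v)) F (expand v z).
Proof.
elim: n F => [|n IHn] F; first by rewrite !big_seq1.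
rewrite !big_wordsS [RHS]big_cons big_cons [X in _ + X]big_cons.
rewrite [X in _ = _ + X](_ : _ =
  \sum_(j <- iota 2 h) \sum_(w <- words (iota 0 h.+2) n) F (j :: w));
  last first.
  rewrite (iotaDl 1 1 h) big_map big_seq [RHS]big_seq; apply: eq_bigr => i.
  rewrite mem_iota => /andP[i0 _]; rewrite IHn; apply: eq_bigr => v _.
  by case: i i0 => // i _; rewrite add1n.
rewrite addrA; congr (_ + _).
rewrite (IHn (fun w => F (0%N :: w))) (IHn (fun w => F (1%N :: w))).
rewrite -big_split; apply: eq_bigr => v _.
rewrite (_ : count_mem 0%N (0%N :: v) = (count_mem 0%N v).+1) //.
by rewrite big_wordsS big_bits.
Qed.

(* A symbol describes one of the first V places of a word in which the letters
   0 and 1 have been merged into a letter with V occurrences: [(true, b)] is an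
   occurrence of the merged letter with label b, and [(false, b)] is a larger
   letter; b is then the label of the occurrence of the merged letter, beyond
   the first V places, that is paired with it (in order). *)
Definition syms := [seq (s, b) | s <- bits, b <- bits].

Definition plain (Z : seq (bool * bool)) := [seq x.2 | x <- Z & x.1].
Definition raised (Z : seq (bool * bool)) := [seq x.2 | x <- Z & ~~ x.1].

(** A mask with its two label words carries the same data as one word of symbols, in which the
    constraints can be read place by place. *)
Lemma big_words_syms (A : nmodType) n
    (F : bitseq -> bitseq -> bitseq -> A) :
  \sum_(s <- words bits n) \sum_(z <- words bits (count id s))
    \sum_(y <- words bits (count negb s)) F s z y =
  \sum_(Z <- words syms n) F (map fst Z) (plain Z) (raised Z).
Proof.
elim: n F => [|n IHn] F; first by rewrite !big_seq1.
rewrite !big_wordsS big_bits big_allpairs_dep !big_bits /=.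
congr (_ + _).
  rewrite -(IHn (fun s z y => F (false :: s) z (false :: y))).
  rewrite -(IHn (fun s z y => F (false :: s) z (true :: y))).
  rewrite -big_split; apply: eq_bigr => s _; rewrite -big_split.
  by apply: eq_bigr => z _; rewrite add1n big_wordsS big_bits.
rewrite -(IHn (fun s z y => F (true :: s) (false :: z) y)).
rewrite -(IHn (fun s z y => F (true :: s) (true :: z) y)).
rewrite -big_split; apply: eq_bigr => s _.
by rewrite add1n big_wordsS big_bits.
Qed.

Lemma big_words_pick (A : nmodType) (z : bitseq) (F : bitseq -> A) :
  \sum_(s <- words bits (size z) | z == s) F s = F z.
Proof.
elim: z F => [|b z IHz] F; first by rewrite big_mkcond big_seq1.
rewrite big_mkcond big_wordsS big_bits -(IHz (fun s => F (b :: s))).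
rewrite [RHS]big_mkcond /=; case: b.
  by rewrite [X in X + _]big1 ?add0r.
by rewrite [X in _ + X]big1 ?addr0.
Qed.

(** From the mask [s] of the merged letters and their labels [z], the mask of the letters that
    become 0. *)
Fixpoint zmask (s z : bitseq) : bitseq :=
  match s, z with
  | true :: s', b :: z' => ~~ b :: zmask s' z'
  | true :: s', [::] => false :: zmask s' [::]
  | false :: s', _ => false :: zmask s' z
  | [::], _ => [::]
  end.

Lemma zmask_expand v z : size z = count_mem 0%N v ->
  [seq a == 0%N | a <- expand v z] = zmask [seq a == 0%N | a <- v] z.
Proof.
elim: v z => [|[|a] v IHv] z //=.
- by case: z => [|b z] //=; rewrite add1n => -[/IHv->]; case: b.
- by rewrite add0n => /IHv->.
Qed.

Lemma zmask_plain Z :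
  zmask (map fst Z) (plain Z) = [seq x.1 && ~~ x.2 | x <- Z].
Proof. by elim: Z => [|[[] b] Z IHZ] //=; rewrite -IHZ. Qed.

Lemma count_plain_raised Z :
  (count negb (plain Z) + count negb (raised Z))%N = count (fun y => ~~ y.2) Z.
Proof.
elim: Z => [|[[] b] Z IHZ] //=; rewrite -IHZ; first by rewrite addnA.
by rewrite addnCA.
Qed.

(** Used for truncated sums: the terms above [N] vanish by nilpotency of [u], those below [j] for
    lack of words. *)
Lemma big_ord_shift (A : nmodType) N j (a : nat -> A) :
  (forall n, (n < j)%N || (N < n)%N -> a n = 0) ->
  \sum_(n < N.+1) a n = \sum_(l < N.+1) a (j + l)%N.
Proof.
move=> a0; rewrite -(big_mkord xpredT a).
rewrite -(big_mkord xpredT (fun l => a (j + l)%N)).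
transitivity (\sum_(0 <= n < j + N.+1) a n).
  rewrite [RHS](big_cat_nat (n := N.+1)) ?leq_addl //=.
  rewrite [X in _ + X]big_nat [X in _ + X]big1 ?addr0 // => i /andP[Ni _].
  by rewrite a0 // Ni orbT.
rewrite (big_cat_nat (n := j)) ?leq_addr //= big_nat [X in X + _]big1 ?add0r.
  by rewrite -{1}[j]add0n big_addn addKn; apply: eq_bigr => i _; rewrite addnC.
by move=> i /andP[_ ij]; rewrite a0 // ij.
Qed.

Lemma big_words_iota1 (A : nmodType) h n (F : seq nat -> A) :
  \sum_(w <- words (iota 0 h.+1) n | count_mem 0%N w == 0%N) F w =
  \sum_(w <- words (iota 1 h) n) F w.
Proof.
elim: n F => [|n IHn] F; first by rewrite big_mkcond !big_seq1.
rewrite big_mkcond !big_wordsS big_cons [X in X + _]big1 // add0r.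
rewrite big_seq [RHS]big_seq; apply: eq_bigr => -[|a]; rewrite mem_iota // => _.
by rewrite -IHn [RHS]big_mkcond.
Qed.

(* The nilpotent [u] stands for the variable of power series truncated at order
   [N.+1], so that all the sums over words may be finite. *)
Section ExcedanceSum.
Variables (A : comNzRingType) (u : A) (N : nat).
Hypothesis uN : u ^+ N.+1 = 0.

(** Stands for a [u]-adic valuation of at least [n]; it justifies dropping the terms beyond the
    truncation. *)
Definition divu (n : nat) (a : A) := exists b, a = u ^+ n * b.

Lemma divu0 n : divu n 0. Proof. by exists 0; rewrite mulr0. Qed.

Lemma divu_sum n (I : Type) (r : seq I) (P : pred I) (F : I -> A) :
  (forall i, P i -> divu n (F i)) -> divu n (\sum_(i <- r | P i) F i).
Proof.
move=> HF; elim/big_ind: _ => [|a b [a' ->] [b' ->]|//]; first exact: divu0.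
by exists (a' + b'); rewrite mulrDr.
Qed.

Lemma divuM m n a b : divu m a -> divu n b -> divu (m + n) (a * b).
Proof. by move=> [a' ->] [b' ->]; exists (a' * b'); rewrite exprD; ring. Qed.

Lemma divuMr n a b : divu n a -> divu n (a * b).
Proof. by move=> [a' ->]; exists (a' * b); rewrite mulrA. Qed.

Lemma divuMl n a b : divu n b -> divu n (a * b).
Proof. by rewrite mulrC; apply: divuMr. Qed.

Lemma divu1M a : divu 1 (u * a). Proof. by exists a; rewrite expr1. Qed.

Lemma divu_eq0 n a : (N < n)%N -> divu n a -> a = 0.
Proof.
by move=> Nn [b ->]; rewrite -(subnK Nn) exprD uN mulr0 mul0r.
Qed.

(** Truncated geometric series, the inverse of [1 - a] when [u] divides [a]. *)
Definition geo (a : A) := \sum_(i < N.+1) a ^+ i.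

Lemma geoP a : divu 1 a -> (1 - a) * geo a = 1.
Proof.
move=> [b ->]; rewrite expr1 -[LHS]opprK -mulNr opprB -subrX1 opprB.
by rewrite exprMn uN mul0r subr0.
Qed.

(* The letter [i.+1] weighs [u] times the first (resp. second) component of the
   [i]-th entry of [L] at a non-excedance (resp. excedance). *)
Definition letter_weight (L : seq (A * A)) (a : nat) (b : bool) : A :=
  if a is i.+1 then
    let x := nth (0, 0) L i in u * (if b then x.2 else x.1)
  else 1.

(* Whether the letter [a] following the prefix [pre] of the word [T] stands
   at a position exceeding its rank in the stable sort of [T]. *)
Definition is_exc (T pre : seq nat) (a : nat) : bool :=
  (count (fun b => b < a)%N T + count_mem a pre < size pre)%N.

Fixpoint wt (L : seq (A * A)) (T pre w : seq nat) : A :=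
  if w is a :: w' then
    letter_weight L a (is_exc T pre a) * wt L T (a :: pre) w'
  else 1.

(* The weight of the letters 1 of [expand v z], where [s] tells the places of
   the letter 0 in [v] and [U] counts the letters 0 of the result; [k] is the
   number of letters other than 1 already read. *)
Fixpoint label_weight (U : nat) (x : A * A) (k : nat) (s z : bitseq) : A :=
  match s with
  | true :: s' =>
      match z with
      | true :: z' => u * (if (U < k)%N then x.2 else x.1) *
                      label_weight U x k s' z'
      | false :: z' => label_weight U x k.+1 s' z'
      | [::] => label_weight U x k.+1 s' [::]
      end
  | false :: s' => label_weight U x k.+1 s' z
  | [::] => 1
  end.

Lemma size_expand v z : size (expand v z) = size v.
Proof. by elim: v z => [|[|a] v IHv] [|b z] //=; rewrite IHv. Qed.

Lemma predn_expand v z : map predn (expand v z) = v.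
Proof. by elim: v z => [|[|a] v IHv] [|[] z] //=; rewrite IHv. Qed.

Lemma count0_expand v z : size z = count_mem 0%N v ->
  count_mem 0%N (expand v z) = count negb z.
Proof.
elim: v z => [|[|a] v IHv] [|b z] //=; rewrite ?add1n ?add0n.
- by move=> [/IHv->]; case: b.
- exact: (IHv [::]).
- exact: (IHv (b :: z)).
Qed.

Lemma expand_cat v v' z z' : size z = count_mem 0%N v ->
  expand (v ++ v') (z ++ z') = expand v z ++ expand v' z'.
Proof.
elim: v z => [|[|a] v IHv] [|b z] //=; rewrite ?add1n ?add0n.
- by move=> [/IHv->].
- by move=> /(IHv [::]) /= ->.
- by move=> /(IHv (b :: z)) /= ->.
Qed.

(** Merging 0 and 1 changes neither the position nor the rank of a letter above 1, so such letters
    keep their weights. The rank of a letter 1 is the number of letters 0 plus the number of earlier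
    letters 1; hence it lies at an excedance when the earlier letters other than 1 outnumber the
    letters 0. *)
Lemma wt_expand x L T P v z : size z = count_mem 0%N v ->
  wt (x :: L) T P (expand v z) =
  wt L (map predn T) (map predn P) v *
  label_weight (count_mem 0%N T) x (size P - count_mem 1%N P)
    [seq a == 0%N | a <- v] z.
Proof.
have Pcnt (Q : seq nat) : (count_mem 1%N Q <= size Q)%N by apply: count_size.
have lt1 (Q : seq nat) : count (fun b => b < 1)%N Q = count_mem 0%N Q.
  by apply: eq_count => -[].
elim: v z P => [|[|a] v IHv] z P.
- by case: z => //; rewrite mulr1.
- case: z => [//|b z] [/IHv{}IHv] /=; rewrite {}IHv /=.
  case: b => /=; rewrite ?mul1r.
    rewrite add1n subSS mulrCA /is_exc lt1.
    by congr (_ * (u * (if _ then _ else _) * _)); rewrite ltn_subRL addnC.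
  by rewrite add0n subSn.
- move=> /= /IHv{}IHv.
  rewrite IHv /= add0n subSn // mulrA.
  congr (_ * _ * _); congr (u * (if _ then _ else _)).
  all: rewrite /is_exc !count_map size_map; congr (_ + _ < _)%N.
  all: by apply: eq_count => -[|b'] //=; rewrite ?eqSS.
Qed.

Lemma divu_wt L T P w : divu (count (predC (pred1 0%N)) w) (wt L T P w).
Proof.
elim: w P => [|a w IHw] P /=; first by exists 1; rewrite mulr1.
by apply: divuM => //; case: a => [|a]; [exists 1; rewrite mulr1|apply: divu1M].
Qed.

Lemma divu_label_weight U x k s z : size z = count id s ->
  divu (count id z) (label_weight U x k s z).
Proof.
elim: s k z => [|[] s IHs] k z /=.
- by case: z => // _; exists 1; rewrite mulr1.
- case: z => [//|b z]; rewrite add1n => -[/IHs{}IHs].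
  by case: b => //=; apply: divuM => //; apply: divu1M.
- by rewrite add0n => /IHs.
Qed.

Lemma label_weight_cat U x k s s' z z' : size z = count id s ->
  label_weight U x k (s ++ s') (z ++ z') =
  label_weight U x k s z *
  label_weight U x (k + (size s - count id z)) s' z'.
Proof.
have cz (y t : bitseq) : size y = count id t -> (count id y <= size t)%N.
  by move=> yt; rewrite (leq_trans (count_size _ _)) // yt count_size.
elim: s k z => [|[] s IHs] k z /=.
- by case: z => // _; rewrite mul1r addn0.
- case: z => [//|b z]; rewrite add1n => -[zs] /=.
  case: b => /=; rewrite IHs //; first by rewrite mulrA.
  by rewrite add0n subSn ?cz // addSnnS.
- by rewrite add0n => zs; rewrite IHs // subSn ?cz // addSnnS.
Qed.

Lemma label_weight_late U x k s z : size z = count id s ->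
  (0 < count id z -> U < k)%N ->
  label_weight U x k s z = (u * x.2) ^+ count id z.
Proof.
elim: s k z => [|[] s IHs] k z /=.
- by case: z.
- case: z => [//|[] z]; rewrite add1n => -[zs] Uk /=.
    by rewrite Uk // IHs ?add1n ?exprS // => _; apply: Uk.
  by rewrite add0n IHs // => /Uk /leqW.
- by rewrite add0n => zs Uk; rewrite IHs // => /Uk /leqW.
Qed.

(** * Adding one letter to the alphabet *)

Section Step.
Variables (U : nat) (x : A * A) (W Ip R0 : A).
Let p := u * x.1.
Let q := u * x.2.
Hypothesis IpP : (1 - p) * Ip = 1.
Hypothesis R0P : (1 - q * W) * R0 = 1.
Let c := (1 - q) * Ip.
Let rho := W * R0.

(** A larger letter carries the factor [W - 1] of the induction hypothesis. Its label 1 weighs [q]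
    because the paired occurrence, beyond the first V places, is always an excedance. *)
Fixpoint sym_weight (k : nat) (Z : seq (bool * bool)) : A :=
  match Z with
  | (true, true) :: Z' => (if (U < k)%N then q else p) * sym_weight k Z'
  | (true, false) :: Z' => sym_weight k.+1 Z'
  | (false, true) :: Z' => (W - 1) * q * sym_weight k.+1 Z'
  | (false, false) :: Z' => (W - 1) * sym_weight k.+1 Z'
  | [::] => 1
  end.

Lemma sym_weightE k Z :
  label_weight U x k (map fst Z) (plain Z) * q ^+ count id (raised Z)
    * (W - 1) ^+ count negb (map fst Z) = sym_weight k Z.
Proof.
elim: Z k => [|[[] []] Z IHZ] k /=; first by rewrite !mul1r.
- by rewrite -IHZ add0n !mulrA; case: ifP.
- by rewrite -IHZ add0n.
- by rewrite -IHZ !add1n !exprS /=; ring.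
- by rewrite -IHZ !add1n add0n !exprS /=; ring.
Qed.

Definition n_one (Z : seq (bool * bool)) := count snd Z.
Definition n_zero (Z : seq (bool * bool)) := count (fun y => ~~ y.2) Z.

Lemma n_one_zero Z : (n_one Z + n_zero Z = size Z)%N.
Proof. exact: (count_predC snd Z). Qed.

Lemma sym_weight_cat k Z Z' :
  sym_weight k (Z ++ Z') = sym_weight k Z *
    sym_weight (k + (size Z - count (fun y => y.1 && y.2) Z)) Z'.
Proof.
have cz (Y : seq (bool * bool)) :
  (count (fun y => y.1 && y.2) Y <= size Y)%N by apply: count_size.
elim: Z k => [|[[] []] Z IHZ] k /=; rewrite ?add1n ?add0n ?mul1r ?addn0 //.
- by rewrite IHZ subSS mulrA.
- by rewrite IHZ subSn // addSnnS.
- by rewrite IHZ subSn // addSnnS mulrA.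
- by rewrite IHZ subSn // addSnnS mulrA.
Qed.

Lemma divu_sym_weight k Z : divu (n_one Z) (sym_weight k Z).
Proof.
rewrite /n_one; elim: Z k => [|[[] []] Z IHZ] k /=; rewrite ?add1n ?add0n //.
- by exists 1; rewrite mulr1.
- by rewrite -add1n; apply: divuM => //; case: ifP => _; apply: divu1M.
- by rewrite -add1n; apply: divuM => //; apply/divuMl/divu1M.
- exact: divuMl.
Qed.

Lemma sym_weight_late k k' Z : (U < k)%N -> (U < k')%N ->
  sym_weight k Z = sym_weight k' Z.
Proof.
elim: Z k k' => [|[[] []] Z IHZ] k k' Uk Uk' //=.
- by rewrite Uk Uk' (IHZ k k').
- by apply: IHZ; apply: leqW.
- by congr (_ * _); apply: IHZ; apply: leqW.
- by congr (_ * _); apply: IHZ; apply: leqW.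
Qed.

(* Among the [U + m] first symbols, [U] have label 0 and [m] have label 1, so
   the last [m] of them have as many labels 0 as the first [U] have labels 1. *)
Definition block_sum k n j :=
  \sum_(Z <- words syms n | n_zero Z == j) sym_weight k Z.
Lemma block_sum_small k n j : (n < j)%N -> block_sum k n j = 0.
Proof.
move=> nj; rewrite /block_sum big_seq_cond big1 // => Z.
move=> /andP[/size_words Zn /eqP Zj].
by move: nj; rewrite -Zn -Zj -(n_one_zero Z) ltnNge leq_addl.
Qed.

Lemma divu_block_sum k n j : divu (n - j) (block_sum k n j).
Proof.
rewrite /block_sum big_seq_cond; apply: divu_sum => Z.
move=> /andP[/size_words Zn /eqP Zj].
have -> : (n - j)%N = n_one Z by rewrite -Zn -Zj -(n_one_zero Z) addnK.
exact: divu_sym_weight.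
Qed.

(** Splits off the first symbol. Only [(true, true)] keeps [k]; the two symbols with label 0 weigh
    [1 + (W - 1) = W] together. *)
Lemma block_sumS k n j : block_sum k n.+1 j =
  (if (U < k)%N then q else p) * block_sum k n j
  + (W - 1) * q * block_sum k.+1 n j
  + W * (if j is j'.+1 then block_sum k.+1 n j' else 0).
Proof.
rewrite /block_sum [LHS]big_mkcond big_wordsS big_allpairs_dep !big_bits /=.
rewrite -!big_mkcond /= -!big_distrr /=.
have -> : W * (if j is j'.+1 then
    \sum_(Z <- words syms n | n_zero Z == j') sym_weight k.+1 Z else 0) =
  W * \sum_(Z <- words syms n | (1 + n_zero Z)%N == j) sym_weight k.+1 Z.
  by case: j => [|j] //; rewrite big_pred0.
ring.
Qed.

Definition block_series k j := \sum_(l < N.+1) block_sum k (j + l) j.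

Lemma block_seriesE k j :
  (1 - (if (U < k)%N then q else p)) * block_series k j =
  (j == 0)%:R + (W - 1) * q * block_series k.+1 j
  + W * (if j is j'.+1 then block_series k.+1 j' else 0).
Proof.
set s := if _ then q else p.
(* At the last length the block sum is divisible by [u ^+ N], so one more factor [u] kills it. *)
have last0 (a : A) k' : divu 1 a -> a * block_sum k' (j + N) j = 0.
  move=> a1; apply: (@divu_eq0 N.+1) => //; rewrite -add1n; apply: divuM => //.
  by have := divu_block_sum k' (j + N) j; rewrite addKn.
have s1 : divu 1 s by rewrite /s; case: ifP => _; apply: divu1M.
have shift (a : A) k' : divu 1 a ->
    \sum_(l < N) a * block_sum k' (j + l) j = a * block_series k' j.
  move=> a1; rewrite /block_series big_ord_recr /= mulrDr last0 // addr0.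
  by rewrite mulr_sumr.
rewrite mulrBl mul1r.
rewrite {1}/block_series big_ord_recl addn0.
under eq_bigr => l _ do rewrite lift0 addnS block_sumS -/s.
rewrite !big_split /= shift // shift; last exact/divuMl/divu1M.
have -> : block_sum k j j +
    (s * block_series k j + (W - 1) * q * block_series k.+1 j +
    \sum_(i < N) W * (if j is j'.+1 then block_sum k.+1 (j + i) j' else 0)) -
    s * block_series k j =
    (W - 1) * q * block_series k.+1 j + (block_sum k j j +
    \sum_(i < N) W * (if j is j'.+1 then block_sum k.+1 (j + i) j' else 0)).
  by ring.
rewrite [RHS]addrAC [RHS]addrC; congr (_ + _).
case: (j) => [|j'].
  rewrite [X in _ + X]big1 ?addr0 => [|i _]; last by rewrite mulr0.
  by rewrite /block_sum mulr0 addr0 big_mkcond big_seq1.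
rewrite add0r block_sumS !(block_sum_small _ (ltnSn j')) !mulr0 !add0r.
rewrite /block_series big_ord_recl addn0.
rewrite mulrDr; congr (_ + _); rewrite mulr_sumr; apply: eq_bigr => i _.
by rewrite lift0 addSnnS.
Qed.

(** Beyond [U] the weights no longer depend on [k], so the recursion closes up: [(1 - q W) T_j =
    [j = 0] + W T_(j-1)], a geometric progression of ratio [rho]. *)
Lemma block_series_late k j : (U < k)%N -> block_series k j = R0 * rho ^+ j.
Proof.
have step j' : block_series U.+1 j' = R0 * ((j' == 0)%:R +
    W * (if j' is i.+1 then block_series U.+1 i else 0)).
  have late i : block_series U.+2 i = block_series U.+1 i.
    apply: eq_bigr => l _; apply: eq_bigr => Z _.
    by apply: sym_weight_late; rewrite ltnS ?leqnSn.
  have := block_seriesE U.+1 j'; rewrite ltnSn late.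
  have -> : (if j' is i.+1 then block_series U.+2 i else 0) =
            (if j' is i.+1 then block_series U.+1 i else 0) by case: j' => // i.
  move: (if _ is _.+1 then _ else 0) (_ == 0)%:R (block_series _ _) => a b T E.
  have -> : b + W * a = (1 - q * W) * T.
    have -> : b + W * a = b + (W - 1) * q * T + W * a - (W - 1) * q * T.
      by ring.
    by rewrite -E; ring.
  by rewrite mulrA [R0 * _]mulrC R0P mul1r.
move=> Uk; have -> : block_series k j = block_series U.+1 j.
  by apply: eq_bigr => l _; apply: eq_bigr => Z _; apply: sym_weight_late.
elim: j => [|j IHj]; rewrite step; first by rewrite mulr0 addr0 expr0.
by rewrite IHj add0r exprS /rho; ring.
Qed.

(** Up to [U] the left factor of the recursion is [1 - p] instead of [1 - q], so each step back
    multiplies by [c]. The bound [d <= j] keeps the term [[j = 0]] out of all steps but the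
    first. *)
Lemma block_series_early d j : (d <= U)%N -> (d <= j)%N ->
  block_series (U - d) j = c ^+ d.+1 * (R0 * rho ^+ j).
Proof.
have late k' i : (U < k')%N -> (1 - q) * block_series k' i = (i == 0)%:R +
    (W - 1) * q * block_series k' i +
    W * (if i is i'.+1 then block_series k' i' else 0).
  move=> Uk; have := block_seriesE k' i; rewrite Uk => ->.
  case: i => [|i]; rewrite !(block_series_late _ (leqW Uk));
    by rewrite !(block_series_late _ Uk).
have Ip_mul (a b : A) : (1 - p) * a = b -> a = Ip * b.
  by move=> <-; rewrite mulrA [Ip * _]mulrC IpP mul1r.
elim: d j => [|d IHd] j dU dj.
  apply: etrans (_ : Ip * ((1 - q) * (R0 * rho ^+ j)) = _); last first.
    by rewrite /c; ring.
  apply: Ip_mul; have := block_seriesE (U - 0) j; rewrite subn0 ltnn => ->.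
  by rewrite -(block_series_late j (ltnSn U)) late.
apply: etrans (_ : Ip * ((1 - q) * (c ^+ d.+1 * (R0 * rho ^+ j))) = _);
  last first.
  by rewrite /c !exprS; ring.
apply: Ip_mul; have := block_seriesE (U - d.+1) j.
rewrite ltnNge leq_subr /= -subSn // subSS => ->.
case: j dj => // j dj; rewrite add0r !IHd //; try exact: ltnW.
have := late U.+1 j.+1 (ltnSn U); rewrite !block_series_late // => E.
rewrite -mulrA [RHS]mulrCA E /=; ring.
Qed.

(** Distributes the powers of [c] and [rho] given by [block_series_early] over the symbols, so that
    the sum over symbol words becomes a product. *)
Definition sym_factor (y : bool * bool) : A :=
  match y with
  | (true, true) => p * c * rho
  | (true, false) => 1
  | (false, true) => (W - 1) * q * rho
  | (false, false) => W - 1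
  end.

Lemma sym_weight_early k Z : (k + size Z <= U)%N ->
  sym_weight k Z * (c ^+ count (fun y => y.1 && y.2) Z * rho ^+ n_one Z) =
  \prod_(y <- Z) sym_factor y.
Proof.
rewrite /n_one; elim: Z k => [|[[] []] Z IHZ] k /= kU.
- by rewrite big_nil !mulr1.
- rewrite big_cons -(IHZ k); last by rewrite (leq_trans _ kU) ?leq_add2l.
  rewrite ltnNge (leq_trans _ kU) ?leq_addr //= ?add1n ?exprS ?exprD; ring.
- by rewrite big_cons -(IHZ k.+1) ?addSnnS //= ?add0n mul1r.
- rewrite big_cons -(IHZ k.+1) ?addSnnS //= ?add0n ?exprS ?exprD; ring.
- rewrite big_cons -(IHZ k.+1) ?addSnnS //= ?add0n; ring.
Qed.

(** A letter 0 prescribed by [S] forces the symbol [(true, false)], of factor 1; at any other place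
    the factors of the three other symbols add up. *)
Lemma sum_sym_factor S :
  \sum_(Z <- words syms (size S) | [seq y.1 && ~~ y.2 | y <- Z] == S)
     \prod_(y <- Z) sym_factor y =
  (p * c * rho + (W - 1) * q * rho + (W - 1)) ^+ count negb S.
Proof.
elim: S => [|b S IHS]; first by rewrite big_mkcond big_seq1 /= big_nil.
rewrite big_mkcond big_wordsS big_allpairs_dep !big_bits /= exprD -IHS.
rewrite [X in _ = _ * X]big_mkcond /=; case: b => /=.
  rewrite mul1r [X in X + _ + _]big1 // [X in _ + X + _]big1 //.
  rewrite [X in _ + (_ + X)]big1 // !add0r addr0.
  by apply: eq_bigr => Z _; rewrite big_cons mul1r eqseq_cons.
rewrite expr1 mulr_sumr [X in _ + (X + _)]big1 // add0r -!big_split /=.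
apply: eq_bigr => Z _; rewrite !eqseq_cons !big_cons /=.
case: ifP => _; ring.
Qed.

(** Here [s] is the mask of the merged letter on the first V places, V being its number of
    occurrences; [z] labels the occurrences there, and [y] the [count negb s] remaining ones. *)
Definition zone_sum S s : A :=
  \sum_(z <- words bits (count id s)) \sum_(y <- words bits (count negb s))
    if (count negb z + count negb y == U)%N && (take U (zmask s z) == S)
    then label_weight U x 0 s z * q ^+ count id y else 0.

Lemma divu_zone_sum S s : divu (size s - U) (zone_sum S s).
Proof.
rewrite /zone_sum big_seq; apply: divu_sum => z /size_words zs.
rewrite big_seq; apply: divu_sum => y /size_words ys.
case: ifP => [/andP[/eqP zyU _]|_]; last exact: divu0.
have -> : (size s - U = count id z + count id y)%N.
  rewrite -zyU -(count_predC id s) -zs -ys.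
  by rewrite -(count_predC id z) -(count_predC id y) addnACA addnK.
apply: divuM; first exact: divu_label_weight.
by exists (x.2 ^+ count id y); rewrite /q exprMn.
Qed.

Lemma zone_sum_wt L S v : (U <= count_mem 0%N v)%N ->
  \sum_(z <- words bits (count_mem 0%N v))
    (let w := expand v z in
     if (count_mem 0%N w == U) && ([seq a == 0%N | a <- take U w] == S)
     then wt (x :: L) w [::] w else 0) =
  wt L v [::] v * zone_sum S [seq a == 0%N | a <- take (count_mem 0%N v) v].
Proof.
set V := count_mem 0%N v => UV.
have Vv : (V <= size v)%N by apply: count_size.
set s := [seq _ | _ <- _].
have sV : size s = V by rewrite size_map size_takel.
have cs1 : count_mem 0%N (take V v) = count id s by rewrite count_map.
have cs2 : count_mem 0%N (drop V v) = count negb s.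
  apply: (@addnI (count id s)); rewrite -{1}cs1 -count_cat cat_take_drop.
  by rewrite -/V -sV -(count_predC id s).
have VE : V = (count id s + count negb s)%N.
  by rewrite -cs1 -cs2 -count_cat cat_take_drop.
rewrite /zone_sum {1}VE big_words_cat mulr_sumr [LHS]big_seq [RHS]big_seq.
apply: eq_bigr => z /size_words zs; rewrite mulr_sumr [LHS]big_seq [RHS]big_seq.
apply: eq_bigr => y /size_words ys /=.
have zyV : size (z ++ y) = V by rewrite size_cat zs ys -VE.
rewrite count0_expand // count_cat.
have -> : [seq a == 0%N | a <- take U (expand v (z ++ y))] = take U (zmask s z).
  rewrite -{1}(cat_take_drop V v) expand_cat ?cs1 //.
  rewrite takel_cat ?size_expand ?size_takel // map_take zmask_expand //.
  by rewrite cs1.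
case: ifP => [/andP[/eqP zyU _]|_]; last by rewrite mulr0.
rewrite wt_expand // predn_expand /= subn0 count0_expand // count_cat zyU.
congr (_ * _); rewrite -{1}(cat_take_drop V v) map_cat -/s label_weight_cat //.
(* If [y] has a label 1, more than [U] of the first V letters differ from 1, so all letters 1 beyond
   them lie at excedances. *)
congr (_ * _); rewrite add0n label_weight_late ?count_map //.
  by rewrite ys -cs2; apply: eq_count.
have cz := count_predC id z; have cy := count_predC id y.
rewrite sV VE -zs -ys => y0; rewrite -zyU -cz -cy -addnA addKn.
rewrite addnCA -{1}[(count negb z + _)%N]add0n ltn_add2r //.
Qed.

(** There are as many masked places as letters 0, and [l] counts the other letters, which carry the
    factors [u]. *)
Definition masked_sum L S := \sum_(l < N.+1)
  \sum_(w <- words (iota 0 (size L).+1) (size S + l) |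
       (count_mem 0%N w == size S) &&
       ([seq a == 0%N | a <- take (size S) w] == S)) wt L w [::] w.

(** Merges 0 and 1: [m] is the number of letters 1, and [s] the mask of the merged letter on the
    first [U + m] places. *)
Lemma masked_sum_consE L S : size S = U ->
  masked_sum (x :: L) S =
  \sum_(m < N.+1) \sum_(s <- words bits (U + m)) zone_sum S s * masked_sum L s.
Proof.
move=> SU; rewrite /masked_sum /= SU.
pose G v := wt L v [::] v *
  zone_sum S [seq a == 0%N | a <- take (count_mem 0%N v) v].
pose a m n := \sum_(v <- words (iota 0 (size L).+1) (U + n) |
  count_mem 0%N v == (U + m)%N) G v.
transitivity (\sum_(n < N.+1) \sum_(m < N.+1) a m n).
  apply: eq_bigr => n _; rewrite big_mkcond big_words_expand.
  rewrite [RHS](exchange_big_dep xpredT) //= big_seq [RHS]big_seq.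
  apply: eq_bigr => v /size_words vn.
  have [UV|VU] := leqP U (count_mem 0%N v).
    rewrite zone_sum_wt // -/(G v).
    have mN : (count_mem 0%N v - U < N.+1)%N.
      rewrite ltnS leq_subLR (leq_trans (count_size _ _)) // vn leq_add2l.
      by rewrite -ltnS.
    rewrite big_mkcond (bigD1 (Ordinal mN)) //= subnKC // eqxx big1 ?addr0 //.
    move=> i; case: ifP => // /eqP vi /eqP []; apply: val_inj => /=.
    by rewrite vi addKn.
  rewrite [RHS]big1 => [|m /eqP E]; last first.
    by move: VU; rewrite E ltnNge leq_addr.
  rewrite big_seq big1 // => z /size_words zv; rewrite count0_expand //.
  case: eqP => // E; move: VU; rewrite -E -zv ltnNge count_size //.
rewrite exchange_big; apply: eq_bigr => m _; rewrite (big_ord_shift (j := m)).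
  transitivity (\sum_(s <- words bits (U + m)) \sum_(l < N.+1)
    \sum_(v <- words (iota 0 (size L).+1) (U + (m + l)) |
            count_mem 0%N v == (U + m)%N)
      if [seq a == 0%N | a <- take (U + m) v] == s
      then wt L v [::] v * zone_sum S s else 0); last first.
    rewrite big_seq [RHS]big_seq; apply: eq_bigr => s /size_words sU.
    rewrite mulr_sumr; apply: eq_bigr => l _; rewrite sU mulr_sumr addnA.
    by rewrite -big_mkcondr; apply: eq_bigr => v _; rewrite mulrC.
  rewrite exchange_big; apply: eq_bigr => l _; rewrite exchange_big /a.
  rewrite big_seq_cond [RHS]big_seq_cond.
  apply: eq_bigr => v /andP[/size_words vU /eqP v0]; rewrite -big_mkcond /G v0.
  set z := [seq _ | _ <- _]; have <- : size z = (U + m)%N.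
    by rewrite size_map size_takel // vU addnA leq_addr.
  by rewrite (big_words_pick z (fun s => wt L v [::] v * zone_sum S s)).
move=> n /orP[nm|Nn]; rewrite /a big_seq_cond.
  rewrite big1 // => v /andP[/size_words vU /eqP v0].
  have := count_size (pred1 0%N) v; rewrite v0 vU leq_add2l.
  by rewrite leqNgt nm.
apply: (divu_eq0 Nn); apply: divu_sum => v /andP[/size_words vU /eqP v0].
rewrite /G v0.
have mn : (m <= n)%N by apply: leq_trans Nn; apply: ltnW.
have -> : n = (n - m + m)%N by rewrite subnK.
apply: divuM.
  have := divu_wt L v [::] v; congr divu.
  apply: (@addnI (count_mem 0%N v)); rewrite count_predC v0 vU.
  by rewrite -addnA subnKC.
set z := [seq _ | _ <- _]; have zm : size z = (U + m)%N.
  by rewrite size_map size_takel // vU leq_add2l.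
by have := divu_zone_sum S z; rewrite zm addKn.
Qed.

(** Cuts the symbol word after [U] places: [S] constrains only the first part, on which the second
    depends only through its number of labels 0 and its starting value of [k]. *)
Lemma sum_zone_sum S m : size S = U ->
  \sum_(s <- words bits (U + m)) zone_sum S s * (W - 1) ^+ count negb s =
  \sum_(Z <- words syms U | [seq y.1 && ~~ y.2 | y <- Z] == S)
     sym_weight 0 Z *
     block_sum (U - count (fun y => y.1 && y.2) Z) m (n_one Z).
Proof.
move=> SU; pose F s z y : A :=
  if (count negb z + count negb y == U)%N && (take U (zmask s z) == S)
  then label_weight U x 0 s z * q ^+ count id y * (W - 1) ^+ count negb s
  else 0.
transitivity (\sum_(s <- words bits (U + m)) \sum_(z <- words bits (count id s))
    \sum_(y <- words bits (count negb s)) F s z y).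
  apply: eq_bigr => s _; rewrite /zone_sum mulr_suml; apply: eq_bigr => z _.
  rewrite mulr_suml; apply: eq_bigr => y _.
  by rewrite /F; case: ifP; rewrite ?mul0r.
rewrite big_words_syms big_words_cat [RHS]big_mkcond big_seq [RHS]big_seq.
apply: eq_bigr => Z /size_words ZU; rewrite /F.
under eq_bigr => Y _.
  rewrite sym_weightE count_plain_raised zmask_plain sym_weight_cat map_cat.
  rewrite take_cat size_map ZU ltnn subnn take0 cats0 count_cat add0n.
over.
case: eqP => ZS /=; last by rewrite big1 // => Y _; rewrite andbF.
rewrite /block_sum mulr_sumr [RHS]big_mkcond; apply: eq_bigr => Y _.
rewrite andbT -/(n_zero Z) -/(n_zero Y) -{1}ZU -(n_one_zero Z) addnC eqn_add2r.
by case: ifP.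
Qed.

Lemma masked_sum_step L :
  (forall S, masked_sum L S = W * (W - 1) ^+ count negb S) ->
  forall S, size S = U ->
  masked_sum (x :: L) S = W * c * R0 * (W * c * R0 - 1) ^+ count negb S.
Proof.
move=> IHL S SU; rewrite masked_sum_consE //.
transitivity (W * \sum_(m < N.+1)
  \sum_(s <- words bits (U + m)) zone_sum S s * (W - 1) ^+ count negb s).
  rewrite mulr_sumr; apply: eq_bigr => m _; rewrite mulr_sumr.
  by apply: eq_bigr => s _; rewrite IHL mulrCA.
under eq_bigr => m _ do rewrite sum_zone_sum //.
rewrite exchange_big /=.
transitivity (W * \sum_(Z <- words syms U | [seq y.1 && ~~ y.2 | y <- Z] == S)
   c * R0 * \prod_(y <- Z) sym_factor y).
  congr (_ * _); rewrite big_seq_cond [RHS]big_seq_cond.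
  apply: eq_bigr => Z /andP[/size_words ZU _].
  set b := count _ Z; set j := n_one Z.
  have bj : (b <= j)%N by apply: sub_count => y /andP[].
  have bU : (b <= U)%N by rewrite -ZU; apply: count_size.
  rewrite (big_ord_shift (j := j)
    (a := fun m => sym_weight 0 Z * block_sum (U - b) m j)).
    rewrite -mulr_sumr -/(block_series _ _) block_series_early //.
    by rewrite -(sym_weight_early (k := 0)) ?ZU // -/b -/j exprS; ring.
  move=> n /orP[nj|Nn]; first by rewrite block_sum_small // mulr0.
  have [nj|jn] := ltnP n j; first by rewrite block_sum_small // mulr0.
  apply: (divu_eq0 Nn); rewrite -(subnKC jn); apply: divuM.
    exact: divu_sym_weight.
  by rewrite subnKC //; apply: divu_block_sum.
rewrite -mulr_sumr -{1}SU sum_sym_factor.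
(* The induction closes because the factor of a place not prescribed to be 0 is the new series minus
   1. *)
suff -> : W * c * R0 - 1 = p * c * rho + (W - 1) * q * rho + (W - 1) by ring.
have -> : W * c * R0 = (1 - p) * Ip * (W * (1 - q) * R0) + p * c * rho.
  by rewrite /c /rho; ring.
rewrite IpP mul1r.
have -> : W * (1 - q) * R0 = (1 - q * W) * R0 * W + (W - 1) * q * rho.
  by rewrite /rho; ring.
by rewrite R0P; ring.
Qed.

End Step.

(** * The series of all words and its inverse *)

Fixpoint word_series (L : seq (A * A)) : A :=
  if L is x :: L' then
    let W := word_series L' in
    W * ((1 - u * x.2) * geo (u * x.1)) * geo (u * x.2 * W)
  else 1.

Lemma masked_sumE L S :
  masked_sum L S = word_series L * (word_series L - 1) ^+ count negb S.
Proof.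
elim: L S => [|x L IHL] S /=; last first.
  have p1 := geoP (divu1M x.1).
  have q1 := geoP (divuMr (word_series L) (divu1M x.2)).
  exact: (masked_sum_step p1 q1 IHL (erefl _)).
(* With the letter 0 alone, the single word of each length fits only the mask without [false], in
   accordance with [0 ^+ j]. *)
have words0 n : words (iota 0 1) n = [:: nseq n 0%N].
  by elim: n => // n IHn; rewrite /words -/words IHn.
have wt0 T n P : wt [::] T P (nseq n 0%N) = 1.
  by elim: n P => //= n IHn P; rewrite IHn mul1r.
rewrite /masked_sum mul1r subrr.
under eq_bigr => l _ do rewrite words0 big_mkcond big_seq1 count_nseq mul1n wt0.
rewrite big_ord_recl big1 => [|i _]; last first.
  by rewrite lift0 -[X in _ == X]addn0 eqn_add2l.
rewrite !addn0 eqxx take_oversize ?size_nseq // map_nseq eqxx /=.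
have -> : (nseq (size S) true == S) = (count negb S == 0)%N.
  by elim: S => // -[] S IHS //=; rewrite eqseq_cons IHS.
by rewrite expr0n addr0; case: eqP.
Qed.

Fixpoint word_den (L : seq (A * A)) : A :=
  if L is x :: L' then
    (1 - u * x.1) * geo (u * x.2) * (word_den L' - u * x.2)
  else 1.

Lemma word_series_den L : word_series L * word_den L = 1.
Proof.
elim: L => [|x L IHL] /=; first by rewrite mul1r.
set W := word_series L in IHL *; set Z := word_den L in IHL *.
set q := u * x.2; set p := u * x.1.
have q1 : (1 - q) * geo q = 1 by apply/geoP/divu1M.
have p1 : (1 - p) * geo p = 1 by apply/geoP/divu1M.
have W1 : (1 - q * W) * geo (q * W) = 1 by apply/geoP/divuMr/divu1M.
have -> : W * ((1 - q) * geo p) * geo (q * W) *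
    ((1 - p) * geo q * (Z - q)) =
  ((1 - q) * geo q) * ((1 - p) * geo p) * geo (q * W) * (W * Z - q * W).
  by ring.
by rewrite q1 p1 IHL !mul1r mulrC.
Qed.

Lemma wtE L T P w :
  wt L T P w = \prod_(j < size w) letter_weight L (nth 0%N w j)
    (count (fun b => b < nth 0 w j)%N T + (count_mem (nth 0%N w j) P +
     count_mem (nth 0%N w j) (take j w)) < size P + j)%N.
Proof.
elim: w P => [|a w IHw] P /=; first by rewrite big_ord0.
rewrite big_ord_recl /= !addn0 IHw; congr (_ * _).
apply: eq_bigr => i _; rewrite !add0n /bump leq0n add1n /=.
by rewrite addSnnS -[(_ + count_mem _ P + _)%N]addnA [((a == _) + _)%N]addnCA.
Qed.

(** The empty mask selects the words without the letter 0. *)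
Lemma sum_wt_den L :
  (\sum_(l < N.+1) \sum_(w <- words (iota 1 (size L)) l) wt L w [::] w) *
  word_den L = 1.
Proof.
rewrite -(word_series_den L); congr (_ * _).
have := masked_sumE L [::]; rewrite /= mulr1 => <-; apply: eq_bigr => l _ /=.
under [RHS]eq_bigl => w do rewrite take0 andbT.
by rewrite (big_words_iota1 (size L) l (fun w => wt L w [::] w)).
Qed.

End ExcedanceSum.

(** * Lattice points *)

Lemma iota1E h : iota 1 h = map succn (iota 0 h).
Proof. by rewrite -(iotaDl 1 0). Qed.

Lemma iota0S h : iota 0 h.+1 = 0%N :: map succn (iota 0 h).
Proof. by rewrite -iota1E. Qed.

Section LatticeSum.
Variables (A : comNzRingType) (u x : A) (N r t : nat).
Hypotheses (uN : u ^+ N.+1 = 0) (t_gt0 : (0 < t)%N).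

(** The offset [s] absorbs the first coordinate of a vector, which yields a recursion on the
    length. *)
Definition lattice_sum s n : A :=
  \sum_(v <- words (iota 0 (r * t).+1) n) x ^+ ((s + sumn v).-1 %/ t).

Definition lattice_series s : A := \sum_(n < N.+1) u ^+ n * lattice_sum s n.

Lemma lattice_seriesE s : lattice_series s =
  x ^+ (s.-1 %/ t) + u * \sum_(a <- iota 0 (r * t).+1) lattice_series (s + a).
Proof.
rewrite /lattice_series big_ord_recl expr0 mul1r; congr (_ + _).
  by rewrite /lattice_sum big_seq1 addn0.
rewrite exchange_big /= mulr_sumr.
under [RHS]eq_bigr => n _ do rewrite -mulr_sumr mulrA -exprS.
rewrite [RHS]big_ord_recr /= uN mul0r addr0; apply: eq_bigr => n _.
rewrite /bump leq0n add1n; congr (_ * _).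
rewrite /lattice_sum big_wordsS; apply: eq_bigr => a _.
by apply: eq_bigr => w _ /=; rewrite addnA.
Qed.

Lemma lattice_series_shift s j : (0 < s)%N ->
  lattice_series (j * t + s) = x ^+ j * lattice_series s.
Proof.
move=> s0; rewrite mulr_sumr; apply: eq_bigr => n _.
rewrite mulrCA; congr (_ * _); rewrite mulr_sumr; apply: eq_bigr => v _.
by rewrite -exprD -addnA -!subn1 -addnBA ?addn_gt0 ?s0 // divnMDl.
Qed.

Let c := (1 - u) * geo N (u * x ^+ r).

Let cE : c * (1 - u * x ^+ r) = 1 - u.
Proof. by rewrite mulrAC -mulrA (geoP uN) ?mulr1 //; apply: divu1M. Qed.

Lemma lattice_series_pow s : (s <= t)%N ->
  lattice_series s = c ^+ s * lattice_series 0.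
Proof.
elim: s => [|s IHs] st; first by rewrite mul1r.
rewrite exprS -mulrA -IHs; last exact: ltnW.
have : (1 - u) * lattice_series s = (1 - u * x ^+ r) * lattice_series s.+1.
  (* The recursions at [s] and [s.+1] share the terms [M]; the remaining end terms are
     [lattice_series s] and, by periodicity, [x ^+ r * lattice_series s.+1]. *)
  set M := \sum_(a <- iota 0 (r * t)) lattice_series (s.+1 + a).
  have E0 : lattice_series s = 1 + u * (lattice_series s + M).
    rewrite {1}lattice_seriesE divn_small ?expr0; last first.
      by rewrite (leq_ltn_trans (leq_pred _)).
    rewrite iota0S big_cons addn0 big_map /M.
    by under eq_bigr => a _ do rewrite -addSnnS.
  have E1 : lattice_series s.+1 = 1 + u * (M + x ^+ r * lattice_series s.+1).
    rewrite {1}lattice_seriesE divn_small // expr0.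
    rewrite -(addn1 (r * t)) iotaD big_cat.
    by rewrite big_seq1 add0n [(s.+1 + _)%N]addnC lattice_series_shift.
  by rewrite !mulrBl !mul1r {1}E0 {1}E1; ring.
move=> E; rewrite -[LHS]mul1r -(geoP uN (divu1M u (x ^+ r))) mulrAC -E /c.
by rewrite mulrAC.
Qed.

(** A positive coordinate is [j * t + i.+1] with [j < r] and [i < t]; it contributes
    [x ^+ j * c ^+ i.+1]. *)
Lemma lattice_series_sum :
  \sum_(a <- iota 0 (r * t).+1) lattice_series a =
  (1 + (\sum_(j < r) x ^+ j) * (\sum_(i < t) c ^+ i.+1)) * lattice_series 0.
Proof.
rewrite iota0S big_cons mulrDl mul1r big_map; congr (_ + _).
elim: r => [|j IHj]; first by rewrite big_nil big_ord0 !mul0r.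
rewrite mulSn addnC iotaD big_cat IHj big_ord_recr /= mulrDl mulrDl.
congr (_ + _); rewrite add0n -[(j * t)%N]addn0 iotaDl big_map.
rewrite -mulrA mulr_suml mulr_sumr -{1}(subn0 t) -/(index_iota 0 t) big_mkord.
apply: eq_bigr => i _; rewrite -addnS lattice_series_shift //.
by rewrite (lattice_series_pow (ltn_ord i)).
Qed.

(** As in [fexc], the color 0 counts [r] at excedances only, and a positive color counts itself
    everywhere. *)
Definition color_letter (a : nat) : A * A :=
  if a == 0%N then (1, x ^+ r) else (x ^+ a, x ^+ a).

Definition letters := [seq color_letter (a %% r) | a <- iota 0 (r * t).+1].

Let block := [seq color_letter a | a <- iota 0 r].

Lemma lettersE : (0 < r)%N ->
  letters = flatten (nseq t block) ++ [:: color_letter 0].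
Proof.
move=> r0; rewrite /letters.
elim: (t) => [|j IHj]; first by rewrite muln0 /= mod0n.
rewrite mulnS -addnS iotaD map_cat [flatten _]/= -catA -IHj; congr (_ ++ _).
  rewrite /block; apply/eq_in_map => a; rewrite mem_iota => /andP[_ ar].
  by rewrite modn_small.
rewrite add0n -[r in iota r]addn0 iotaDl -map_comp.
by apply: eq_map => a /=; rewrite modnDl.
Qed.

(** The two weights of a positive color agree, so the quotient in the recursion is 1 and only the
    subtraction remains. *)
Lemma word_den_colors m L :
  word_den u N ([seq (color_letter \o succn) a | a <- iota 0 m] ++ L) =
  word_den u N L - u * \sum_(j < m) x ^+ j.+1.
Proof.
elim: m L => [|m IHm] L; first by rewrite big_ord0 mulr0 subr0.
rewrite -addn1 iotaD map_cat -catA IHm addn1 big_ord_recr /= add0n.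
by rewrite (geoP uN) ?mul1r; [ring | apply: divu1M].
Qed.

(** The alphabet consists of [t] blocks of colors [0, ..., r - 1] and a last letter of color 0. A
    block sends [D] to [c (D - u x X)], and [X (1 - x) = 1 - x ^+ r] brings the result into the
    stated form. *)
Lemma word_den_letters : (0 < r)%N ->
  word_den u N letters =
  1 - u * (1 + (\sum_(j < r) x ^+ j) * (\sum_(i < t) c ^+ i.+1)).
Proof.
move=> r0; rewrite lettersE //; set X := \sum_(j < r) _.
have XE : X * (1 - x) = 1 - x ^+ r.
  by have := subrX1 x r; rewrite -/X => E; rewrite -[RHS]opprB E; ring.
elim: (t) => [|j IHj].
  rewrite big_ord0 mulr0 addr0 /= mulr1 -/c cE; ring.
rewrite /= -catA; move: (flatten _ ++ _) IHj => L IHj.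
have blockE : word_den u N (block ++ L) =
    c * (word_den u N L - u * x * X).
  rewrite /block -(prednK r0) iota0S /= -map_comp word_den_colors mulr1 -/c.
  congr (_ * _); rewrite -addrA -opprD; congr (_ - _).
  rewrite /X -[in RHS](prednK r0) [in RHS]big_ord_recr /= -mulrA -mulrDr.
  rewrite [x * (_ + _)]mulrDr -exprS prednK // mulr_sumr; congr (_ * (_ + _)).
  by apply: eq_bigr => i _; rewrite exprS.
rewrite blockE IHj big_ord_recl expr1.
have -> : \sum_(i < j) c ^+ (lift ord0 i).+1 = c * \sum_(i < j) c ^+ i.+1.
  by rewrite mulr_sumr; apply: eq_bigr => i _; rewrite -exprS.
set S := \sum_(i < j) _.
have -> : 1 - u * (1 + X * (c + c * S)) =
  c * (1 - u * x ^+ r) - u * X * c * (1 + S) by rewrite cE; ring.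
have -> : x ^+ r = 1 - X * (1 - x) by rewrite XE; ring.
ring.
Qed.

Lemma lattice_series_den : (0 < r)%N ->
  lattice_series 0 * word_den u N letters = 1.
Proof.
move=> r0; rewrite word_den_letters //.
have := lattice_series_sum; set K := 1 + _ * _ => KE.
have E := lattice_seriesE 0; rewrite div0n expr0 KE in E.
by rewrite mulrBr mulr1 {1}E; ring.
Qed.

End LatticeSum.

(* The flag excedance number of the colored permutation whose one-line
   notation sorts [w] stably and whose colors are the residues mod [r]. *)
Definition word_fexc (r : nat) (w : seq nat) : nat :=
  \sum_(j < size w)
    let a := nth 0%N w j in
    if (a %% r == 0)%N
    then (r * (count (fun b => b < a) w + count_mem a (take j w) < j))%N
    else (a %% r)%N.

Lemma wt_letters (A : comNzRingType) (u x : A) r t w :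
  all (fun a => a < (r * t).+1)%N w ->
  wt u (letters x r t) (map succn w) [::] (map succn w) =
  u ^+ size w * x ^+ word_fexc r w.
Proof.
move=> /(all_nthP 0%N) wP.
have -> : u ^+ size w = \prod_(j < size w) u by rewrite prodr_const card_ord.
rewrite wtE size_map /word_fexc -prodrXr -big_split; apply: eq_bigr => j _ /=.
rewrite (nth_map 0%N) // -map_take !count_map.
set a := nth 0%N w j; have aP := wP j (ltn_ord j).
rewrite /letter_weight (nth_map 0%N) ?size_iota // nth_iota // !add0n.
rewrite (eq_count (a2 := fun b => b < a)%N) //.
rewrite (eq_count (a1 := preim succn _) (a2 := pred1 a)) //.
congr (_ * _); rewrite /color_letter; case: eqP => _ /=; last by case: ifP.
by case: ifP; rewrite ?muln1 ?muln0.
Qed.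

(** Both series are inverse to the same element [word_den]. *)
Lemma word_series_eq (A : comNzRingType) (u x : A) N r t :
  u ^+ N.+1 = 0 -> (0 < t)%N -> (0 < r)%N ->
  \sum_(n < N.+1) u ^+ n *
    (\sum_(w <- words (iota 0 (r * t).+1) n) x ^+ word_fexc r w) =
  \sum_(n < N.+1) u ^+ n * lattice_sum x r t 0 n.
Proof.
move=> uN t0 r0.
have E1 := sum_wt_den uN (letters x r t).
have E2 := lattice_series_den x uN t0 r0.
rewrite -/(lattice_series u x N r t 0) -[RHS]mulr1 -E1 mulrCA E2 mulr1.
apply: eq_bigr => n _; rewrite size_map size_iota.
rewrite iota1E big_words_map.
rewrite mulr_sumr big_seq [RHS]big_seq; apply: eq_bigr => w wn.
rewrite wt_letters ?(size_words wn) //; apply/allP => a aw.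
by have := words_sub wn aw; rewrite mem_iota.
Qed.

(** * Comparison of coefficients *)

Lemma rmorph_word_fexc (K A : comNzRingType)
    (f : {rmorphism {poly {poly K}} -> A}) N r t :
  f 'X ^+ N.+1 = 0 -> (0 < t)%N -> (0 < r)%N ->
  f (\poly_(m < N.+1)
       (\sum_(w <- words (iota 0 (r * t).+1) m) 'X^(word_fexc r w))) =
  f (\poly_(m < N.+1) lattice_sum 'X r t 0 m).
Proof.
move=> uN t0 r0; have := word_series_eq (f 'X%:P) uN t0 r0.
have fE (F : nat -> {poly K}) :
    f (\poly_(m < N.+1) F m) = \sum_(m < N.+1) f 'X ^+ m * f (F m)%:P.
  rewrite poly_def rmorph_sum; apply: eq_bigr => m _.
  by rewrite -mul_polyC rmorphM rmorphXn mulrC.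
rewrite !fE => E; apply: etrans (etrans E _); last first.
  apply: eq_bigr => m _; congr (_ * _); rewrite /lattice_sum !rmorph_sum /=.
  by apply: eq_bigr => w _; rewrite !rmorphXn.
apply: eq_bigr => m _; congr (_ * _); rewrite !rmorph_sum /=.
by apply: eq_bigr => w _; rewrite !rmorphXn.
Qed.

Lemma word_fexc_lattice (K : comNzRingType) r t n : (0 < t)%N -> (0 < r)%N ->
  \sum_(w <- words (iota 0 (r * t).+1) n) 'X^(word_fexc r w) =
  lattice_sum 'X r t 0 n :> {poly K}.
Proof.
(* Modulo [u ^+ n.+1] the variable becomes nilpotent, while polynomials in [u] of degree at most [n]
   are still determined by their residues. *)
move=> t0 r0; pose h : {poly {poly K}} := 'X^(n.+1).
have hE : mk_monic h = 'X^(n.+1) by rewrite mk_monic_Xn.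
have in_h_inj (p q : {poly {poly K}}) : (size p <= n.+1)%N ->
    (size q <= n.+1)%N -> in_qpoly h p = in_qpoly h q -> p = q.
  move=> sp sq /(congr1 val) E.
  by rewrite -(@in_qpoly_small _ h p) -1?(@in_qpoly_small _ h q)
    ?hE ?size_polyXn ?ltnS.
have un : in_qpoly h 'X ^+ n.+1 = 0.
  by rewrite -rmorphXn; apply: val_inj; rewrite /= hE Pdiv.RingMonic.rmodpp
    // monicXn.
have /in_h_inj E := rmorph_word_fexc un t0 r0.
have := congr1 (fun p : {poly {poly K}} => p`_n)
  (E (size_poly _ _) (size_poly _ _)).
by rewrite !coef_poly ltnSn.
Qed.

Local Open Scope nat_scope.

(** * Standardization *)

Lemma big_tupleS (A : nmodType) (T : finType) n (F : n.+1.-tuple T -> A) :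
  (\sum_(w : n.+1.-tuple T) F w =
   \sum_(a : T) \sum_(w : n.-tuple T) F [tuple of a :: w])%R.
Proof.
rewrite pair_big /=.
rewrite (reindex (fun p : T * n.-tuple T => [tuple of p.1 :: p.2])) //=.
exists (fun w : n.+1.-tuple T => (thead w, [tuple of behead w])) => [[a w]|w] _.
  by congr pair; apply: val_inj.
by rewrite [RHS]tuple_eta; apply: val_inj.
Qed.

Lemma big_tuple_words (A : nmodType) q n (F : seq nat -> A) :
  (\sum_(w : n.-tuple 'I_q) F (map val w) =
   \sum_(w <- words (iota 0 q) n) F w)%R.
Proof.
elim: n F => [|n IHn] F.
  rewrite big_seq1 (big_pred1 [tuple]) //= => w.
  by apply/esym/eqP; apply: val_inj; case: w => -[].
rewrite big_tupleS big_wordsS -val_enum_ord big_map big_enum.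
apply: eq_bigr => a _; rewrite val_enum_ord.
exact: (IHn (fun w => F (val a :: w))).
Qed.

(** * The permutation sorting an injective key *)

Section Sorting.
Variables (n : nat) (key : 'I_n -> nat).
Hypothesis key_inj : injective key.

Definition rank (j : 'I_n) : nat := #|[set j' | key j' < key j]|.

Definition sorts (s : 'S_n) : bool :=
  [forall i : 'I_n, forall j : 'I_n, (i < j) ==> (key (s i) < key (s j))].

Lemma sortsP (s : 'S_n) :
  reflect (forall i j : 'I_n, (i < j) = (key (s i) < key (s j))) (sorts s).
Proof.
apply: (iffP idP) => [ss i j|ss]; last first.
  by apply/forallP => i; apply/forallP => j; rewrite ss implybb.
have sij (k l : 'I_n) : k < l -> key (s k) < key (s l).
  by move=> kl; have /forallP/(_ k)/forallP/(_ l)/implyP := ss; apply.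
apply/idP/idP; first exact: sij.
case: (ltngtP i j) => // [/sij/ltnW|/val_inj->]; last by rewrite ltnn.
by rewrite leqNgt => /negP.
Qed.

Lemma rank_sorts (s : 'S_n) i : sorts s -> rank (s i) = i.
Proof.
move=> /sortsP ss; rewrite /rank.
have -> : [set j' | key j' < key (s i)] = s @: [set i' : 'I_n | i' < i].
  apply/setP => j; rewrite inE; apply/idP/imsetP => [|[k]]; last first.
    by rewrite inE ss => ? ->.
  by move=> ji; exists (s^-1 j)%g; rewrite ?permKV // inE ss permKV.
rewrite card_imset; last exact: perm_inj.
rewrite -sum1dep_card (big_ord_narrow (ltnW (ltn_ord i))).
by rewrite sum1_card card_ord.
Qed.

Lemma rank_lt j : rank j < n.
Proof.
rewrite -[X in _ < X]card_ord; apply: proper_card; apply/properP; split.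
  exact/fintype.subsetP.
by exists j; rewrite // inE ltnn.
Qed.

Lemma rank_mono j j' : key j < key j' -> rank j < rank j'.
Proof.
move=> jj'; apply: proper_card; apply/properP; split.
  by apply/fintype.subsetP => k; rewrite !inE => /ltn_trans; apply.
by exists j; rewrite inE // ltnn.
Qed.

(** The ranks of distinct keys form a permutation, and sorting means being its inverse. *)
Lemma card_sorts : #|[set s | sorts s]| = 1.
Proof.
have rank_inj : injective (fun j => Ordinal (rank_lt j)).
  move=> j j' [E]; apply: key_inj; apply/eqP.
  by case: ltngtP => // /rank_mono; rewrite E ltnn.
apply/eqP/cards1P; exists (perm rank_inj)^-1%g; apply/setP => s.
rewrite !inE; apply/idP/eqP => [ss|->].
  apply/permP => i; apply: (@perm_inj _ (perm rank_inj)); rewrite permKV permE.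
  by apply: val_inj; rewrite /= rank_sorts.
apply/forallP => i; apply/forallP => j; apply/implyP => ij.
rewrite ltnNge; apply/negP; rewrite leq_eqVlt => /orP[/eqP/key_inj/perm_inj E|].
  by rewrite E ltnn in ij.
have rk k : rank ((perm rank_inj)^-1%g k) = k.
  by have := permKV (perm rank_inj) k => /(congr1 val); rewrite permE.
by move=> /rank_mono; rewrite !rk ltnNge ltnW.
Qed.

End Sorting.

Lemma ltn_lex n a b s s' : s < n -> s' < n ->
  (a * n + s < b * n + s') = (a < b) || (a == b) && (s < s').
Proof.
have lex c d u v : u < n -> c < d -> c * n + u < d * n + v.
  move=> un cd; have := leq_mul cd (leqnn n); rewrite mulSn => H.
  by rewrite (leq_trans _ (leq_addr _ _)) // (leq_trans _ H) // addnC ltn_add2r.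
move=> sn sn'; case: (ltngtP a b) => /= ab.
- by rewrite lex.
- by rewrite ltnNge ltnW ?lex.
- by rewrite ab ltn_add2l.
Qed.

(** Compares triples of level, color and position: the level must rise strictly exactly when the
    other two entries descend. *)
Lemma ltn_lex3 r n h h' a a' s s' :
  a < r -> a' < r -> s < n -> s' < n -> s != s' ->
  ((r * h + a) * n + s < (r * h' + a') * n + s') =
  (h + ((a' < a) || (a == a') && (s' < s)) <= h').
Proof.
move=> ar ar' sn sn' ne; rewrite ltn_lex // ![r * _]mulnC ltn_lex //.
have -> : (h * r + a == h' * r + a') = (h == h') && (a == a').
  apply/eqP/andP => [E|[/eqP-> /eqP->] //].
  have r0 := leq_ltn_trans (leq0n a) ar.
  have := congr1 (divn^~ r) E; have := congr1 (modn^~ r) E.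
  by rewrite !modnMDl !divnMDl // !modn_small // !divn_small // !addn0 => -> ->.
case: (ltngtP h h') => hh' /=.
- by case: (_ || _); rewrite ?addn1 ?addn0 // ltnW.
- by apply/esym/negbTE; rewrite -ltnNge ltn_addr.
- have leqb (b : bool) : (h' + b <= h') = ~~ b.
    by case: b; rewrite ?addn1 ?addn0 ?ltnn ?leqnn.
  rewrite hh' leqb.
  by move: ne; case: (ltngtP a a'); case: (ltngtP s s').
Qed.

Lemma ltn_addn_subn t m d : t < d -> t + m.+1 - d < m.+1.
Proof. lia. Qed.

Lemma last_color_max r m (x : colored_perm r m.+1) :
  last_color x = tnth x.2 ord_max.
Proof.
rewrite /last_color -nth_last size_map size_tuple (nth_map (tnth x.2 ord_max)).
  by rewrite [RHS](congr1 val (tnth_nth (tnth x.2 ord_max) x.2 ord_max)).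
by rewrite size_tuple.
Qed.

Lemma ceil_fdesE r m (x : colored_perm r m.+1) : 0 < r ->
  ceil_fdes x = des x + (0 < tnth x.2 ord_max).
Proof.
move=> r0; rewrite /ceil_fdes /fdes last_color_max.
move: (tnth x.2 ord_max) => c.
have r_gt0 : (0 < r%:R :> rat)%R by rewrite ltr0n.
have [->|c_gt0] := posnP c.
  rewrite !addn0 natrM mulrAC divff ?mul1r ?lt0r_neq0 //.
  by rewrite -[((des x)%:R)%R]/(((des x)%:Z)%:~R)%R intrKceil.
rewrite (@ceil_def _ _ (des x + 1)%:Z) //.
rewrite PoszD addrK -PoszD ltr_pdivlMr // ler_pdivrMr // -!natrM.
rewrite ltr_nat ler_nat mulnC -[X in X < _]addn0 ltn_add2l c_gt0 /=.
by rewrite mulnDl mul1n mulnC leq_add2l ltnW.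
Qed.

(** * Words with a given colored standardization *)

Section Fiber.
Variables (r t m : nat) (s : 'S_m.+1) (c : m.+1.-tuple 'I_r).
Hypothesis r0 : 0 < r.
Let n := m.+1.
Let q := (r * t).+1.

(** Letter first, then position: sorting by this key is the stable sort of the word. *)
Definition key (w : n.-tuple 'I_q) (j : 'I_n) : nat := tnth w j * n + j.

Lemma key_inj w : injective (key w).
Proof.
move=> i j /(congr1 (modn^~ n)).
by rewrite /key !modnMDl !modn_small // => /val_inj.
Qed.

Lemma rank_key w j : rank (key w) j =
  count (fun b => b < tnth w j) (map val w) +
  count_mem (tnth w j : nat) (take j (map val w)).
Proof.
have nthE k (kn : k < n) : nth 0 (map val w) k = tnth w (Ordinal kn).
  by rewrite (nth_map (tnth w j)) ?size_tuple // -(tnth_nth _ w (Ordinal kn)).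
have nthE' (i : 'I_n) : nth 0 (map val w) i = tnth w i.
  by rewrite nthE; congr (nat_of_ord (tnth _ _)); apply: val_inj.
have sz : size (map val w) = n by rewrite size_map size_tuple.
rewrite -!sum1_count (big_nth 0) [X in _ = _ + X](big_nth 0) !big_mkord.
rewrite size_takel ?sz; last exact: ltnW.
under [X in _ = _ + X]eq_bigl => k do rewrite nth_take //.
rewrite /rank -sum1dep_card (bigID (fun j' : 'I_n => tnth w j' < tnth w j)) /=.
congr (_ + _).
  apply: eq_bigl => i; rewrite nthE' /key ltn_lex //.
  by case: (tnth w i < tnth w j); rewrite ?andbF.
rewrite -(big_ord_narrow_cond (F := fun=> 1)
  (P := fun i : 'I_n => nth 0 (map val w) i == tnth w j :> nat)
  (ltnW (ltn_ord j))) /=.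
apply: eq_bigl => i; rewrite nthE' /key ltn_lex //.
by case: (ltngtP (tnth w i) (tnth w j)) => /= _; rewrite ?andbF ?andbT.
Qed.

Definition descent (i i' : 'I_n) : bool :=
  (tnth c i' < tnth c i) || (tnth c i == tnth c i' :> nat) && (s i' < s i).

Definition des_before (i : 'I_n) : nat :=
  #|[set p : 'I_n * 'I_n |
      [&& p.2 == p.1.+1 :> nat, descent p.1 p.2 & p.2 <= i]]|.

Lemma des_before_max : des_before ord_max = des ((s, c) : colored_perm r n).
Proof.
rewrite /des /des_before; apply: eq_card => p; rewrite !inE /=.
by rewrite -ltnS ltn_ord andbT.
Qed.

Lemma des_before_succ (i i' : 'I_n) : i' = i.+1 :> nat ->
  des_before i' = des_before i + descent i i'.
Proof.
move=> ii'; rewrite /des_before.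
rewrite (cardsD1 (i, i')) inE /= ii' eqxx leqnn andbT /= addnC; congr (_ + _).
apply: eq_card => -[j j']; rewrite !inE /= xpair_eqE.
case: (j' =P j.+1 :> nat) => /= [j'E|_]; last by rewrite andbF.
rewrite -!val_eqE /= j'E ii' eqSS andbb ltnS [in RHS]ltn_neqAle.
by case: (descent j j'); rewrite ?andbF.
Qed.

Lemma des_before_le (i : 'I_n) : des_before i <= i.
Proof.
case: i => i; elim: i => [|i IHi] ni.
  rewrite /des_before (_ : [set _ | _] = finset.set0) ?cards0 //.
  by apply/setP => p; rewrite !inE leqn0; case: eqP => //= ->; rewrite andbF.
rewrite (@des_before_succ (Ordinal (ltnW ni))) //=.
by apply: leq_trans (leq_add (IHi (ltnW ni)) (leq_b1 _)) _; rewrite addn1.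
Qed.

(* [level_key h i] compares lexicographically the letter of color [tnth c i] on
   level [h i] and its position. *)
Definition level_key (h : 'I_n -> nat) (i : 'I_n) : nat :=
  (r * h i + tnth c i) * n + s i.

Lemma level_key_succ h (i i' : 'I_n) : i' = i.+1 :> nat ->
  (level_key h i < level_key h i') = (h i + descent i i' <= h i').
Proof.
move=> ii'; apply: ltn_lex3 => //.
by rewrite val_eqE (inj_eq perm_inj) -val_eqE /= ii' neq_ltn ltnSn.
Qed.

Lemma ord_homo (R : rel nat) (g : 'I_n -> nat) : transitive R ->
  (forall i i' : 'I_n, i' = i.+1 :> nat -> R (g i) (g i')) ->
  forall i j : 'I_n, i < j -> R (g i) (g j).
Proof.
move=> Rtr gS i j; move: {2}(j - i) (leqnn (j - i)) => d.
elim: d j => [|d IHd] j ijd ij; first by lia.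
have j1 : j.-1 < n by apply: leq_ltn_trans (leq_pred _) (ltn_ord j).
have [ij1|ij1] := ltnP i j.-1.
  apply: (Rtr (g (Ordinal j1))); first by apply: IHd => //=; lia.
  by apply: gS => /=; lia.
by apply: gS; lia.
Qed.

Lemma level_key_le h (i j : 'I_n) : level_key h i < level_key h j ->
  r * h i + tnth c i <= r * h j + tnth c j.
Proof. by rewrite /level_key ltn_lex // => /orP[/ltnW|/andP[/eqP->]]. Qed.

Definition fiber := [set w : n.-tuple 'I_q |
  sorts (key w) s && [forall i, tnth w (s i) %% r == tnth c i]].

Definition level (w : n.-tuple 'I_q) (i : 'I_n) : nat := tnth w (s i) %/ r.

Lemma fiberE w i :
  w \in fiber -> tnth w (s i) = r * level w i + tnth c i :> nat.
Proof.
rewrite inE => /andP[_ /forallP/(_ i)/eqP <-].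
by rewrite mulnC -divn_eq.
Qed.

Lemma fiber_succ w (i i' : 'I_n) : w \in fiber -> i' = i.+1 :> nat ->
  level w i + descent i i' <= level w i'.
Proof.
move=> wF ii'; rewrite -level_key_succ // /level_key -!fiberE //.
move: wF; rewrite inE => /andP[/sortsP ws _].
by rewrite -[X in X < _]/(key w (s i)) -[X in _ < X]/(key w (s i')) -ws ii'.
Qed.

Lemma fiber_des_before w i : w \in fiber -> des_before i <= level w i.
Proof.
move=> wF; case: i => i; elim: i => [|i IHi] ni.
  by apply: leq_trans (des_before_le _) _.
have ni' : i < n by apply: ltnW.
rewrite (@des_before_succ (Ordinal ni')) //.
apply: leq_trans (@fiber_succ w (Ordinal ni') _ wF _) => //.
by rewrite leq_add2r.
Qed.

Lemma fiber_max w : w \in fiber ->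
  level w ord_max + (0 < tnth c ord_max) <= t.
Proof.
move=> wF; have := ltn_ord (tnth w (s ord_max)).
rewrite fiberE // ltnS; have [->|c0] := posnP.
  by rewrite !addn0 leq_pmul2l.
move=> H; rewrite addn1 -(ltn_pmul2l r0); apply: leq_trans H.
by rewrite -[X in X < _]addn0 ltn_add2l.
Qed.

(** Read in sorted order, a word of the fiber amounts to its levels, which increase weakly, strictly
    at descents, and end at most at [t - [c_n > 0]]. Subtracting [des_before] leaves an arbitrary
    weakly increasing sequence in [{0, ..., t - delta}]. *)
Lemma card_fiber :
  #|fiber| = 'C(t + n - ceil_fdes ((s, c) : colored_perm r n), n).
Proof.
rewrite ceil_fdesE // -des_before_max; set delta := (des_before _ + _)%N.
have [delta_t|t_delta] := leqP delta t; last first.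
  rewrite bin_small; last exact: (ltn_addn_subn m t_delta).
  apply/eqP; rewrite cards_eq0; apply/eqP/setP => w; rewrite finset.in_set0.
  apply/negP => wF.
  move: t_delta; rewrite ltnNge => /negP; apply.
  by apply: leq_trans (fiber_max wF); rewrite leq_add2r fiber_des_before.
rewrite -addnBAC // addnC -card_sorted_tuples.
pose h (z : n.-tuple 'I_(t - delta).+1) i := tnth z i + des_before i.
pose F z : n.-tuple 'I_q := [tuple inord (r * h z (s^-1 j)%g +
  tnth c (s^-1 j)%g) | j < n].
have hS (z : n.-tuple 'I_(t - delta).+1) : sorted leq (map val z) ->
    forall i i' : 'I_n, i' = i.+1 :> nat ->
    level_key (h z) i < level_key (h z) i'.
  move=> /(sortedP 0) zS i i' ii'; rewrite level_key_succ // /h.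
  rewrite (des_before_succ ii') addnA leq_add2r leq_add2r.
  have := zS i; rewrite size_map size_tuple -ii' => /(_ (ltn_ord i')).
  by rewrite !(nth_map (tnth z i)) ?size_tuple // -!tnth_nth.
have FE (z : n.-tuple 'I_(t - delta).+1) i : sorted leq (map val z) ->
    tnth (F z) (s i) = r * h z i + tnth c i :> nat.
  move=> zS; rewrite tnth_mktuple permK inordK // ltnS.
  apply: (@leq_trans (r * h z ord_max + tnth c ord_max)).
    have := leq_ord i; rewrite leq_eqVlt => /orP[/eqP im|im].
      by rewrite (_ : i = ord_max) //; apply: val_inj.
    by apply: level_key_le (ord_homo ltn_trans (hS z zS) _).
  have zm : tnth z ord_max <= t - delta by rewrite -ltnS.
  have cr := ltn_ord (tnth c ord_max).
  rewrite /h -[t in _ <= r * t](subnK delta_t) /delta addnA.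
  rewrite [r * (_ + _ + _)]mulnDr leq_add //.
    by rewrite leq_pmul2l // leq_add2r.
  by case: (nat_of_ord (tnth c ord_max)) cr => // k /ltnW; rewrite muln1.
have FI : {in [set z : n.-tuple 'I_(t - delta).+1 | sorted leq (map val z)] &,
    injective F}.
  move=> z z'; rewrite !inE => zS z'S Fzz'; apply: eq_from_tnth => i.
  have := FE z i zS; rewrite Fzz' FE // => /addIn /eqP.
  by rewrite eqn_pmul2l // eqn_add2r => /eqP/val_inj.
rewrite -(card_in_imset FI); apply: eq_card => w; apply/idP/imsetP.
  move=> wF.
  have lS (i i' : 'I_n) : i' = i.+1 :> nat ->
      level w i - des_before i <= level w i' - des_before i'.
    move=> ii'; rewrite (des_before_succ ii').
    have := fiber_succ wF ii'; have := fiber_des_before i wF; lia.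
  have l_max i : level w i - des_before i < (t - delta).+1.
    rewrite ltnS; apply: (@leq_trans (level w ord_max - des_before ord_max)).
      have := leq_ord i; rewrite leq_eqVlt => /orP[/eqP im|im].
        by rewrite (_ : i = ord_max) //; apply: val_inj.
      exact: (ord_homo leq_trans lS).
    have H := fiber_max wF; rewrite /delta addnC subnDA leq_sub2r //.
    rewrite -(leq_add2r (0 < tnth c ord_max)).
    by rewrite subnK ?(leq_trans _ H) ?leq_addl.
  pose z : n.-tuple 'I_(t - delta).+1 := [tuple Ordinal (l_max i) | i < n].
  have zS : sorted leq (map val z).
    apply/(sortedP 0) => i; rewrite size_map size_tuple => i1.
    have nthE k (kn : k < n) : nth 0 (map val z) k =
        level w (Ordinal kn) - des_before (Ordinal kn).
      rewrite (nth_map (tnth z (Ordinal kn))) ?size_tuple //.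
      by rewrite -(tnth_nth _ z (Ordinal kn)) tnth_mktuple.
    by rewrite (nthE _ (ltnW i1)) (nthE _ i1); apply: lS.
  exists z; rewrite ?inE //; apply: eq_from_tnth => j; apply: val_inj => /=.
  rewrite -[j](permKV s) FE // fiberE //; congr (_ * _ + _).
  by rewrite /h tnth_mktuple /= subnK // fiber_des_before.
case=> z; rewrite inE => zS ->; rewrite inE; apply/andP; split; last first.
  by apply/forallP => i; rewrite FE // mulnC modnMDl modn_small.
apply/forallP => i; apply/forallP => j; apply/implyP => ij.
have := ord_homo ltn_trans (hS z zS) ij.
by rewrite /level_key -!FE.
Qed.

(** In the fiber the position [s i] has rank [i], so rank below position means [i < s i]. *)
Lemma fexc_fiber w : w \in fiber ->
  word_fexc r (map val w) = fexc ((s, c) : colored_perm r n).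
Proof.
move=> wF; rewrite /word_fexc size_map size_tuple (reindex_perm s) /=.
rewrite /fexc -sum1dep_card big_distrr /= [X in _ = X + _]big_mkcond -big_split.
apply: eq_bigr => i _ /=.
rewrite (nth_map (tnth w (s i))) ?size_tuple // -(tnth_nth _ w (s i)).
rewrite -rank_key rank_sorts; last by move: wF; rewrite inE => /andP[].
rewrite fiberE // mulnC modnMDl modn_small //.
by case: eqP => [->|_]; case: ltnP => _; rewrite ?muln1 ?muln0 ?addn0.
Qed.

End Fiber.

Lemma ceil_fdes_le r m (x : colored_perm r m.+1) : 0 < r -> ceil_fdes x <= m.+1.
Proof.
case: x => s c r0; rewrite ceil_fdesE // -des_before_max.
by apply: leq_trans (leq_add (des_before_le _ _ _) (leq_b1 _)) _; rewrite addn1.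
Qed.

Lemma card_words_fexc r t m e : 0 < r ->
  #|[set w : m.+1.-tuple 'I_(r * t).+1 | word_fexc r (map val w) == e]| =
  \sum_(x : colored_perm r m.+1 | fexc x == e)
    'C(t + m.+1 - ceil_fdes x, m.+1).
Proof.
move=> r0; rewrite -sum1dep_card.
transitivity (\sum_(w : m.+1.-tuple 'I_(r * t).+1 |
      word_fexc r (map val w) == e)
    \sum_(s : 'S_m.+1 | sorts (key w) s) 1).
  by apply: eq_bigr => w _; rewrite sum1dep_card card_sorts //; apply: key_inj.
rewrite (exchange_big_dep xpredT) //=.
transitivity (\sum_(s : 'S_m.+1) \sum_(c : m.+1.-tuple 'I_r)
    \sum_(w in fiber t s c | word_fexc r (map val w) == e) 1).
  apply: eq_bigr => s _.
  rewrite (partition_big (fun w : m.+1.-tuple 'I_(r * t).+1 =>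
    [tuple Ordinal (ltn_pmod (tnth w (s i)) r0) | i < m.+1]) xpredT) //=.
  apply: eq_bigr => c _; apply: eq_bigl => w; rewrite inE.
  rewrite -!andbA andbCA; congr andb; rewrite andbC; congr andb.
  apply/eqP/forallP => [<- i|wc]; first by rewrite tnth_mktuple.
  by apply: eq_from_tnth => i; rewrite tnth_mktuple; exact/val_inj/eqP/wc.
rewrite pair_big [RHS]big_mkcond; apply: eq_bigr => -[s c] _ /=.
case: ifP => [fe|fe].
  rewrite -card_fiber // -sum1_card; apply: eq_bigl => w.
  by case wF: (w \in _) => //=; rewrite (fexc_fiber wF).
by rewrite big1 // => w /andP[wF]; rewrite (fexc_fiber wF) fe.
Qed.

Local Open Scope ring_scope.

(** * Ehrhart polynomial *)

Lemma coef_sumXn (T : finType) (F : T -> nat) e :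
  (\sum_(w : T) 'X^(F w) : {poly rat})`_e = #|[set w | F w == e]%SET|%:R.
Proof.
rewrite coef_sum -sum1dep_card natr_sum [RHS]big_mkcond; apply: eq_bigr => w _.
by rewrite coefXn eq_sym; case: eqP.
Qed.

Lemma card_lattice_slice r t m e : (0 < t)%N -> (0 < r)%N ->
  #|[set v : m.+1.-tuple 'I_(r * t).+1 |
      (sumn (map val v)).-1 %/ t == e]%SET|%N =
  (\sum_(x : colored_perm r m.+1 | fexc x == e)
    'C(t + m.+1 - ceil_fdes x, m.+1))%N.
Proof.
move=> t0 r0; rewrite -card_words_fexc //.
apply/eqP; rewrite -(eqr_nat rat) -!coef_sumXn; apply/eqP.
rewrite (@big_tuple_words {poly rat} _ _
  (fun v => 'X^((sumn v).-1 %/ t))).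
rewrite (@big_tuple_words {poly rat} _ _ (fun v => 'X^(word_fexc r v))).
by rewrite (word_fexc_lattice _ _ t0 r0).
Qed.

(** * Binomial polynomials and their star series *)

Definition bin_poly (n d : nat) : {poly rat} :=
  (n`!%:R)^-1 *: \prod_(i < n) ('X + ((n - d)%:R - i%:R)%:P).

Lemma ffact_natr (N n : nat) : (N ^_ n)%:R = \prod_(i < n) (N%:R - i%:R) :> rat.
Proof.
elim: n => [|n IHn]; first by rewrite ffactn0 big_ord0.
rewrite ffactnSr natrM IHn big_ord_recr /=.
have [nN|Nn] := leqP n N; first by rewrite natrB.
by rewrite -IHn ffact_small // !mul0r.
Qed.

(** Covers [t = 0], where the star series takes the value of the polynomial. *)
Lemma horner_bin_poly n d t : (d <= n)%N ->
  (bin_poly n d).[t%:R] = 'C(t + n - d, n)%:R.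
Proof.
move=> dn; rewrite hornerZ horner_prod.
under eq_bigr => i _ do rewrite hornerD hornerX hornerC addrA -natrD addnBA //.
rewrite -ffact_natr -bin_ffact natrM mulrCA mulVf ?mulr1 //.
by rewrite pnatr_eq0 -lt0n fact_gt0.
Qed.

Definition diff (a : fps) : fps :=
  fun t => a t - (if t is t'.+1 then a t' else 0).

Lemma fps_mul_diff (p : {poly rat}) (a : fps) :
  fps_mul (fps_of_poly ((1 - 'X) * p)) a =1 fps_mul (fps_of_poly p) (diff a).
Proof.
move=> k; rewrite /fps_mul /fps_of_poly /diff.
under eq_bigr => i _ do rewrite mulrBl mul1r coefB coefXM mulrBl.
under [RHS]eq_bigr => i _ do rewrite mulrBr.
rewrite !sumrB; congr (_ - _).
rewrite big_ord_recl mul0r add0r [RHS]big_ord_recr /= subnn mulr0 addr0.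
by apply: eq_bigr => i _; rewrite /bump leq0n add1n -(subnSK (ltn_ord i)).
Qed.

(** The coefficients of [z^d / (1 - z)^k]. *)
Definition shifted_bin (d k : nat) : fps := fun t =>
  if k is k'.+1 then (if (d <= t)%N then 'C(t - d + k', k')%:R else 0)
  else (t == d)%:R.

Lemma diff_shifted_bin d k : diff (shifted_bin d k.+1) =1 shifted_bin d k.
Proof.
move=> t; rewrite /diff /shifted_bin; case: t => [|t].
  rewrite subr0 leqn0 eq_sym; case: d => [|d]; last by case: k.
  by case: k => [|k]; rewrite ?bin0 // subn0 !add0n !binn.
have [dt|td|<-] := ltngtP t.+1 d.
- by rewrite leqNgt (ltn_trans (ltnSn t) dt) /= subr0; case: k.
- rewrite ltnS in td; rewrite td subSn //; case: k => [|k].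
    by rewrite !bin0 subrr.
  by rewrite addSn binS natrD addrAC subrr add0r addSnnS.
- by rewrite ltnn subr0 subnn !add0n binn; case: k => [|k]; rewrite ?binn.
Qed.

Lemma fps_mul_shifted_bin d k :
  fps_mul (fps_of_poly ((1 - 'X) ^+ k)) (shifted_bin d k) =1
  fun m => (m == d)%:R.
Proof.
elim: k => [|k IHk] m.
  rewrite /fps_mul /fps_of_poly big_ord_recl coef1 mul1r subn0 big1 ?addr0 //.
  by move=> i _; rewrite lift0 coef1 mul0r.
rewrite exprS fps_mul_diff -IHk; apply: eq_bigr => i _.
by rewrite diff_shifted_bin.
Qed.

Lemma binE n d t : (d <= n)%N -> 'C(t + n - d, n)%:R = shifted_bin d n.+1 t.
Proof.
move=> dn; rewrite /shifted_bin; case: leqP => dt; first by rewrite addnBAC.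
by rewrite bin_small // ltn_subLR ?(leq_trans dn) ?leq_addl // ltn_add2r.
Qed.

Lemma fps_mul_sum (I : finType) (P : pred I) (p : {poly rat}) (a : I -> fps) m :
  fps_mul (fps_of_poly p) (fun t => \sum_(i | P i) a i t) m =
  \sum_(i | P i) fps_mul (fps_of_poly p) (a i) m.
Proof.
rewrite /fps_mul exchange_big; apply: eq_bigr => j _.
by rewrite mulr_sumr.
Qed.

Lemma star_bin_poly (I : finType) (P : pred I) (d : I -> nat) n :
  (forall i, P i -> d i <= n)%N ->
  fps_mul (fps_of_poly ((1 - 'X) ^+ n.+1))
    (fun t => (\sum_(i | P i) bin_poly n (d i)).[t%:R]) =1
  fps_of_poly (\sum_(i | P i) 'X^(d i)).
Proof.
move=> dn m.
transitivity (fps_mul (fps_of_poly ((1 - 'X) ^+ n.+1))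
    (fun t => \sum_(i | P i) shifted_bin (d i) n.+1 t) m).
  apply: eq_bigr => j _; congr (_ * _); rewrite horner_sum.
  by apply: eq_bigr => i /dn di; rewrite horner_bin_poly // binE.
rewrite fps_mul_sum /fps_of_poly coef_sum; apply: eq_bigr => i _.
by rewrite fps_mul_shifted_bin coefXn.
Qed.

Lemma slice_bounds r n k t S : (0 < t)%N -> (0 < k)%N -> (k <= r * n)%N ->
  (S <= r * n * t)%N ->
  (S.-1 %/ t == r * n - k)%N =
  (k.-1 * t <= r * n * t - S)%N &&
  (if k == (r * n)%N then r * n * t - S <= k * t else r * n * t - S < k * t)%N.
Proof.
move=> t0 k0; move: (r * n)%N => M kM; set e := (M - k)%N.
have ME : M = (k.-1 + 1 + e)%N by rewrite addn1 prednK // subnKC.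
have -> : (k == M) = (e == 0)%N by rewrite /e subn_eq0 eqn_leq kM.
have -> : (k * t = k.-1 * t + t)%N by rewrite -{1}(prednK k0) mulSn addnC.
clearbody e; rewrite ME !mulnDl mul1n eqn_leq -[X in X && _]ltnS.
rewrite ltn_divLR // leq_divRL // mulSn.
move bE: (e * t)%N => b; move: (k.-1 * t)%N => a SM.
case: eqP => [e0|/eqP e0].
  by rewrite e0 mul0n in bE; rewrite -bE in SM *; lia.
have : (0 < b)%N by rewrite -bE muln_gt0 lt0n e0.
by clear -t0 SM; lia.
Qed.

Lemma card_eq_fin (T : finType) (U : Type) (f : T -> U) (A : {set T}) :
  injective f -> ([set f v | v in [set` A]] #= `I_#|A|)%classic%card.
Proof.
move=> f_inj; rewrite card_eq_sym; apply: card_eq_trans (card_II) _.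
rewrite card_eq_sym.
have -> : [set f v | v in [set` A]]%classic =
    [set f (enum_val i) | i in [set: 'I_#|A|]]%classic.
  apply/seteqP; split => [y [v vA <-]|y [i _ <-]] /=.
    by exists (enum_rank_in vA v) => //; rewrite enum_rankK_in.
  by exists (enum_val i) => //; apply: enum_valP.
apply: inj_card_eq => i j _ _ /f_inj; exact: enum_val_inj.
Qed.

(** * Lattice points of the dilated multi-hypersimplex *)

Section Geometry.
Variables (R : realType) (r n k t : nat).
Hypotheses (t0 : (0 < t)%N) (k0 : (0 < k)%N) (kM : (k <= r * n)%N).
Let B := multi_hypersimplex R r n k.

Lemma scaled_mem (x : 'rV[R]_n) (a : 'I_n -> nat) :
  (forall i, a i <= r * t)%N -> (forall i, t%:R * x ord0 i = (a i)%:R) ->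
  B x <-> ((k.-1 * t <= \sum_i a i) &&
    (if k == r * n then \sum_i a i <= k * t else \sum_i a i < k * t))%N.
Proof.
move=> ar xa; have tR : (0 : R) < t%:R by rewrite ltr0n.
have sumE : t%:R * (\sum_i x ord0 i) = (\sum_i a i)%:R.
  by rewrite mulr_sumr natr_sum; apply: eq_bigr => i _; rewrite xa.
have -> : (k.-1 * t <= \sum_i a i)%N = (k%:R - 1 <= \sum_i x ord0 i).
  rewrite -(ler_pM2l tR) sumE -{2}(prednK k0) -addn1 natrD addrK.
  by rewrite -natrM ler_nat mulnC.
have -> : (if k == r * n then \sum_i a i <= k * t else \sum_i a i < k * t)%N =
    (\sum_i x ord0 i < k%:R ?<= if (k == r * n)%N).
  rewrite -(lteif_pM2l _ tR) sumE -natrM mulnC.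
  by case: (k == _)%N; rewrite /= ?ler_nat ?ltr_nat mulnC.
rewrite /B /multi_hypersimplex /=; split=> [[_ H1 H2]|/andP[H1 H2]].
  by rewrite H1 H2.
split=> // i.
apply/andP; split; rewrite -(ler_pM2l tR) xa ?mulr0 ?ler0n //.
by rewrite -natrM ler_nat mulnC.
Qed.

Definition lattice_point (v : n.-tuple 'I_(r * t).+1) : 'rV[R]_n :=
  \row_i (r * t - tnth v i)%N%:R.

Lemma lattice_point_inj : injective lattice_point.
Proof.
move=> v w vw; apply: eq_from_tnth => i; apply: val_inj => /=.
have := congr1 (fun y : 'rV[R]_n => y ord0 i) vw; rewrite !mxE => /eqP.
rewrite eqr_nat => /eqP E.
by have := congr1 (subn (r * t)) E; rewrite !subKn // leq_ord.
Qed.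

Lemma dilate_lattice :
  (dilate t B `&` integer_lattice R n =
   [set lattice_point v | v in [set` [set v : n.-tuple 'I_(r * t).+1 |
      (sumn (map val v)).-1 %/ t == r * n - k]%N%SET]])%classic.
Proof.
have tR : (t%:R : R) != 0 by rewrite pnatr_eq0 -lt0n.
have vE (v : n.-tuple 'I_(r * t).+1) :
    (\sum_i (r * t - tnth v i) = r * n * t - sumn (map val v))%N.
  rewrite sumnE big_map big_tuple sumnB => [|i _]; last exact: leq_ord.
  by rewrite sum_nat_const card_ord mulnC mulnAC.
have vle (v : n.-tuple 'I_(r * t).+1) : (sumn (map val v) <= r * n * t)%N.
  rewrite sumnE big_map big_tuple -mulnA.
  have -> : (r * (n * t) = \sum_(i < n) r * t)%N.
    by rewrite sum_nat_const card_ord mulnCA.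
  by apply: leq_sum => i _; apply: leq_ord.
apply/seteqP; split=> y /=.
  move=> [[x Bx xy] yint].
  have ynat i : y ord0 i \is a Num.nat.
    rewrite natrEint yint -xy mxE mulr_ge0 //.
    by case: Bx => /(_ i)/andP[].
  pose a i := Num.truncn (y ord0 i).
  have aE i : (a i)%:R = y ord0 i by apply: truncnK.
  have ar i : (a i <= r * t)%N.
    rewrite -(ler_nat R) aE -xy mxE mulnC natrM ler_wpM2l //.
    by case: Bx => /(_ i)/andP[].
  pose v : n.-tuple 'I_(r * t).+1 := [tuple inord (r * t - a i) | i < n].
  have va i : (r * t - tnth v i = a i)%N.
    by rewrite tnth_mktuple inordK ?subKn // ltnS leq_subr.
  exists v; last by apply/rowP => i; rewrite mxE va aE.
  rewrite inE slice_bounds // -vE; under eq_bigr => i _ do rewrite va.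
  have xa i : t%:R * x ord0 i = (a i)%:R by rewrite aE -xy mxE.
  exact/(scaled_mem ar xa).
move=> [v]; rewrite inE => vA <-; split.
  exists (t%:R^-1 *: lattice_point v); last by rewrite scalerA mulfV ?scale1r.
  apply/(@scaled_mem _ (fun i => r * t - tnth v i)%N) => [i|i|].
  - exact: leq_subr.
  - by rewrite !mxE mulrA mulfV ?mul1r.
  - by rewrite vE -slice_bounds.
by move=> i; rewrite mxE; apply: intr_nat.
Qed.

End Geometry.

Theorem theorem4p6 (R : realType) (r n k : nat) (hr : (1 <= r)%N)
    (hn : (1 <= n)%N) (hk1 : (1 <= k)%N) (hkrn : (k <= r * n)%N) :
  let B := multi_hypersimplex R r n k in
  is_ehrhart B (ehrhart B) /\
  ehrhart_star B =1
    fps_of_poly (\sum_(x : colored_perm r n | fexc x == (r * n - k)%N)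
                   'X^(ceil_fdes x)).
Proof.
case: n hn hkrn => // m _ hkrn B.
have le_m (x : colored_perm r m.+1) : fexc x == (r * m.+1 - k)%N ->
    (ceil_fdes x <= m.+1)%N by move=> _; apply: ceil_fdes_le.
pose E : {poly rat} := \sum_(x : colored_perm r m.+1 |
  fexc x == (r * m.+1 - k)%N) bin_poly m.+1 (ceil_fdes x).
have BE : is_ehrhart B E.
  move=> t t0; exists #|[set v : m.+1.-tuple 'I_(r * t).+1 |
      (sumn (map val v)).-1 %/ t == r * m.+1 - k]%N%SET|.
    by rewrite dilate_lattice //; apply/card_eq_fin/lattice_point_inj.
  rewrite card_lattice_slice // natr_sum horner_sum; apply: eq_bigr => x /le_m.
  exact: horner_bin_poly.
(* Since [E] is a witness, [xget] returns an Ehrhart polynomial, and uniqueness identifies it with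
   [E]. *)
have EhB : ehrhart B = E.
  apply: is_ehrhart_unique (BE); rewrite /ehrhart.
  exact: (@xgetPex _ 0 [set p | is_ehrhart B p]%classic (ex_intro _ E BE)).
rewrite /ehrhart_star EhB; split=> //; exact: star_bin_poly.
Qed.
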